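(* Let $C$ and $C'$ be symmetrizable generalized Cartan matrices, let $\mathcal{C}=(C,I,H,\Pi,\Pi^{\vee})$ and $\mathcal{C}'=(C',J,H',\Pi',(\Pi')^{\vee})$ be root data associated to them, and suppose that $\mathcal{C}'\subseteq_{\iota}\mathcal{C}$ is a sub-root datum. Let $B^{-}=B^{-}(C)\subset L(C)$ be the negative Borel subalgebra of the Kac--Moody bialgebra $L(C)$, with the Lie bialgebra structure restricted from $L(C)$, and $\mathbb{N}$-graded by the grading coming from the sub-root datum (that is, $\deg f_i=1$ if $i\in I\setminus\iota(J)$, $\deg f_i=0$ if $i\in\iota(J)$, $\deg h=0$ for $h\in H$). Then $\mathfrak{b}=\mathfrak{b}(\mathcal{C},\mathcal{C}',\iota):=\bigoplus_{n>0}B^{-}(C)_n$, with the bracket, action, coaction and braided cobracket described in the context, is a braided-Lie bialgebra in the category of left $B^{-}(C)_0$-modules and left $B^{-}(C)_0$-comodules, in fact in the category of Lie crossed modules over $B^{-}(C)_0$. Moreover $$B^{-}(C)\;\cong\;\mathfrak{b}\,{>\!\!\lhd\!\cdot}\,B^{-}(C)_0$$ as Lie bialgebras, where the right-hand side is the bosonisation of $\mathfrak{b}$ by $B^{-}(C)_0$.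
   Context: Throughout, $k$ is an algebraically closed field of characteristic $0$, $\mathbb{N}=\{0,1,2,\dots\}$, $\tau(v\otimes w)=w\otimes v$, and $a\wedge b=a\otimes b-b\otimes a$. For $x$ in a Lie algebra, $\mathrm{ad}_x(y\otimes z)=[x,y]\otimes z+y\otimes[x,z]$. **Lie bialgebras.** A Lie bialgebra is a Lie algebra $\mathfrak g$ with a linear map $\delta:\mathfrak g\to\mathfrak g\otimes\mathfrak g$ satisfying $\delta+\tau\delta=0$, $(\delta\otimes\mathrm{id})\delta+\text{cyclic}=0$ and $\delta([x,y])=\mathrm{ad}_x(\delta y)-\mathrm{ad}_y(\delta x)$. It is $\mathbb N$-graded if $\mathfrak g=\bigoplus_{n\in\mathbb N}\mathfrak g_n$ is a graded Lie algebra and $\delta(\mathfrak g_n)\subseteq\bigoplus_{i+j=n}\mathfrak g_i\otimes\mathfrak g_j$. **Kac--Moody bialgebras.** A generalized Cartan matrix is an integer matrix $C=(C_{ij})_{i,j\in I}$ ($I$ finite, $|I|=n$) with $C_{ii}=2$, $C_{ij}\le 0$ for $i\ne j$, and $C_{ij}=0\Rightarrow C_{ji}=0$. It is symmetrizable if there is a non-singular diagonal matrix $D=\mathrm{diag}(d_i)$ with $DC$ symmetric ($d_iC_{ij}=d_jC_{ji}$). A minimal realization $(H,\Pi,\Pi^\vee)$ of $C$ consists of a $k$-vector space $H$ of dimension $2n-\mathrm{rank}\,C$, a linearly independent set $\Pi=\{h_i\mid i\in I\}\subset H$ and a linearly independent set $\Pi^\vee=\{\alpha_i\mid i\in I\}\subset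 H^*$ with $\alpha_j(h_i)=C_{ij}$; then $\mathcal C=(C,I,H,\Pi,\Pi^\vee)$ is called a root datum associated to $C$. For $C$ symmetrizable, the Kac--Moody algebra $L(C)$ is the Lie algebra generated by the vector space $H$ and elements $e_i,f_i$ ($i\in I$) with relations $[x,y]=0$, $[e_i,f_j]=\delta_{ij}h_i$, $[x,e_i]=\alpha_i(x)e_i$, $[x,f_i]=-\alpha_i(x)f_i$ ($x,y\in H$), and $(\mathrm{ad}\,e_i)^{1-C_{ij}}e_j=0=(\mathrm{ad}\,f_i)^{1-C_{ij}}f_j$ for $i\neq j$. It is a Lie bialgebra (the Kac--Moody bialgebra) with $\delta e_i=\tfrac{d_i}{2}e_i\wedge h_i$, $\delta f_i=\tfrac{d_i}{2}f_i\wedge h_i$, $\delta x=0$ for $x\in H$, extended by the cocycle condition. The negative Borel subalgebra $B^-(C)$ is the Lie subalgebra generated by $f_i$ ($i\in I$) and $H$. **Sub-root data.** For root data $\mathcal C=(C,I,H,\Pi,\Pi^\vee)$ and $\mathcal C'=(C',J,H',\Pi',(\Pi')^\vee)$, we say $\mathcal C'$ is a sub-root datum of $\mathcal C$ via $\iota$, written $\mathcal C'\subseteq_\iota\mathcal C$, if $\iota:J\to I$ is injective, $C'_{ij}=C_{\iota(i)\iota(j)}$ for $i,j\in J$, and there is an injective linear map $s:H'\to H$ with $s(h'_i)=h_{\iota(i)}$ and $\alpha_{\iota(i)}\circ s=\alpha'_i$ for all $i\in J$. **Crossed modules and braided-Lie bialgebras.** Let $\mathfrak f$ be a Lie bialgebra.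 A (left) Lie crossed module over $\mathfrak f$ is a left $\mathfrak f$-module $(V,\triangleright)$ with a left Lie coaction $\beta:V\to\mathfrak f\otimes V$, i.e. $(\delta\otimes\mathrm{id})\beta=(\mathrm{id}-\tau_{12})(\mathrm{id}\otimes\beta)\beta$, such that, writing $\delta\xi=\xi_{(1)}\otimes\xi_{(2)}$ and $\beta(v)=v^{(1)}\otimes v^{(2)}$ (summation understood), $$\beta(\xi\triangleright v)=[\xi,v^{(1)}]\otimes v^{(2)}+v^{(1)}\otimes\xi\triangleright v^{(2)}+\xi_{(1)}\otimes\xi_{(2)}\triangleright v .$$ Tensor products carry the action $\xi\triangleright(v\otimes w)=\xi\triangleright v\otimes w+v\otimes\xi\triangleright w$ and the coaction $v\otimes w\mapsto v^{(1)}\otimes v^{(2)}\otimes w+w^{(1)}\otimes v\otimes w^{(2)}$. The infinitesimal braiding is $$\psi(v\otimes w)=w^{(1)}\triangleright v\otimes w^{(2)}-v^{(1)}\triangleright w\otimes v^{(2)}-w^{(2)}\otimes w^{(1)}\triangleright v+v^{(2)}\otimes v^{(1)}\triangleright w .$$ A braided-Lie bialgebra in this category is a Lie crossed module $\mathfrak b$ with a Lie bracket $\mathfrak b\otimes\mathfrak b\to\mathfrak b$ and a Lie cobracket $\underline\delta:\mathfrak b\to\mathfrak b\otimes\mathfrak b$ (anticocommutative, co-Jacobi) that are both module and comodule maps, such that $\underline\delta([x,y])=\mathrm{ad}_x(\underline\delta y)-\mathrm{ad}_y(\underline\delta x)-\psi(x\otimes y)$. **Bosonisation.** The bosonisation $\mathfrak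 b\,{>\!\!\lhd\!\cdot}\,\mathfrak f$ is the Lie bialgebra on $\mathfrak b\oplus\mathfrak f$ in which $\mathfrak b$ is a Lie subalgebra, $\mathfrak f$ is a Lie sub-bialgebra, $[\xi,x]=\xi\triangleright x$, and $\delta x=\underline\delta x+\beta(x)-\tau\beta(x)$ for $x\in\mathfrak b$, $\xi\in\mathfrak f$. **Structure on $\mathfrak b(\mathcal C,\mathcal C',\iota)$.** Let $\pi:B^-(C)\to B^-(C)_0$ be the projection that is the identity in degree $0$ and zero in positive degrees, so $\mathfrak b=\mathrm{Ker}\,\pi$. Take on $\mathfrak b$ the bracket of $B^-(C)$, the adjoint action of $B^-(C)_0$, the coaction $\beta=(\pi\otimes\mathrm{id})\circ\delta$, and $\underline\delta=(\mathrm{id}-\pi)^{\otimes 2}\circ\delta$. *)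

(* Defs.v *)
From HB Require Import structures.
From mathcomp Require Import all_boot all_order all_algebra.
From mathcomp Require Import boolp classical_sets.

Set Implicit Arguments.
Unset Strict Implicit.
Unset Printing Implicit Defensive.

Import GRing.Theory.
Local Open Scope ring_scope.
Local Open Scope quotient_scope.

(* [V \ox W] is the quotient of the formal linear combinations of pairs by the
   least congruence containing the vector space axioms and bilinearity. *)
Section TensorTerms.
Variables (k : fieldType) (V W : lmodType k).

Inductive tterm : Type :=
| TPure of V & W
| TZero
| TAdd of tterm & tterm
| TScale of k & tterm.

Inductive teq : tterm -> tterm -> Prop :=
| teq_refl s : teq s s
| teq_sym s t : teq s t -> teq t s
| teq_trans t s u : teq s t -> teq t u -> teq s u
| teq_add s s' t t' : teq s s' -> teq t t' -> teq (TAdd s t) (TAdd s' t')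
| teq_scale a s s' : teq s s' -> teq (TScale a s) (TScale a s')
| teq_addA s t u : teq (TAdd s (TAdd t u)) (TAdd (TAdd s t) u)
| teq_addC s t : teq (TAdd s t) (TAdd t s)
| teq_add0 s : teq (TAdd TZero s) s
| teq_scaleA a b s : teq (TScale a (TScale b s)) (TScale (a * b) s)
| teq_scale0 s : teq (TScale 0 s) TZero
| teq_scale1 s : teq (TScale 1 s) s
| teq_scaleDr a s t : teq (TScale a (TAdd s t)) (TAdd (TScale a s) (TScale a t))
| teq_scaleDl a b s : teq (TScale (a + b) s) (TAdd (TScale a s) (TScale b s))
| teq_pureDl v v' w : teq (TPure (v + v') w) (TAdd (TPure v w) (TPure v' w))
| teq_pureDr v w w' : teq (TPure v (w + w')) (TAdd (TPure v w) (TPure v w'))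
| teq_pureZl a v w : teq (TPure (a *: v) w) (TScale a (TPure v w))
| teq_pureZr a v w : teq (TPure v (a *: w)) (TScale a (TPure v w)).

HB.instance Definition _ := gen_eqMixin tterm.
HB.instance Definition _ := gen_choiceMixin tterm.

Definition teqb (s t : tterm) : bool := `[< teq s t >].

Lemma teqb_refl : reflexive teqb.
Proof. by move=> s; apply/asboolP/teq_refl. Qed.
Lemma teqb_sym : symmetric teqb.
Proof. by move=> s t; apply/asboolP/asboolP; apply: teq_sym. Qed.
Lemma teqb_trans : transitive teqb.
Proof.
by move=> t s u /asboolP st /asboolP tu; apply/asboolP/(teq_trans st tu).
Qed.

Canonical teqb_equiv := EquivRel teqb teqb_refl teqb_sym teqb_trans.

Definition tensor := {eq_quot teqb}.
HB.instance Definition _ := Choice.on tensor.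
HB.instance Definition _ := EqQuotient.on tensor.

Definition tcls (s : tterm) : tensor := \pi_tensor s.

Lemma tclsP s t : tcls s = tcls t <-> teq s t.
Proof.
split; first by move/eqmodP => /asboolP.
by move=> st; apply/eqmodP/asboolP.
Qed.

Lemma trepr (x : tensor) : tcls (repr x) = x.
Proof. exact: reprK. Qed.

Lemma trepr_eq s : teq (repr (tcls s)) s.
Proof. by apply/tclsP; rewrite trepr. Qed.

Definition tensor_zero : tensor := tcls TZero.
Definition tensor_add (x y : tensor) : tensor := tcls (TAdd (repr x) (repr y)).
Definition tensor_scale a (x : tensor) : tensor := tcls (TScale a (repr x)).
Definition tensor_opp (x : tensor) : tensor := tensor_scale (-1) x.

Lemma tcls_add s t : tensor_add (tcls s) (tcls t) = tcls (TAdd s t).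
Proof. by apply/tclsP/teq_add; exact: trepr_eq. Qed.
Lemma tcls_scale a s : tensor_scale a (tcls s) = tcls (TScale a s).
Proof. by apply/tclsP/teq_scale; exact: trepr_eq. Qed.

Lemma tensor_addA : associative tensor_add.
Proof.
move=> x y z; rewrite -(trepr x) -(trepr y) -(trepr z) !tcls_add.
exact/tclsP/teq_addA.
Qed.
Lemma tensor_addC : commutative tensor_add.
Proof.
move=> x y; rewrite -(trepr x) -(trepr y) !tcls_add; exact/tclsP/teq_addC.
Qed.
Lemma tensor_add0 : left_id tensor_zero tensor_add.
Proof. by move=> x; rewrite -(trepr x) tcls_add; exact/tclsP/teq_add0. Qed.
Lemma tensor_scaleA a b x :
  tensor_scale a (tensor_scale b x) = tensor_scale (a * b) x.
Proof. by rewrite -(trepr x) !tcls_scale; exact/tclsP/teq_scaleA. Qed.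
Lemma tensor_scale1 : left_id 1 tensor_scale.
Proof. by move=> x; rewrite -(trepr x) tcls_scale; exact/tclsP/teq_scale1. Qed.
Lemma tensor_scaleDr : right_distributive tensor_scale tensor_add.
Proof.
move=> a x y; rewrite -(trepr x) -(trepr y) !(tcls_add, tcls_scale).
exact/tclsP/teq_scaleDr.
Qed.
Lemma tensor_scaleDl x a b :
  tensor_scale (a + b) x = tensor_add (tensor_scale a x) (tensor_scale b x).
Proof.
by rewrite -(trepr x) !(tcls_add, tcls_scale); exact/tclsP/teq_scaleDl.
Qed.
Lemma tensor_addN : left_inverse tensor_zero tensor_opp tensor_add.
Proof.
move=> x; rewrite /tensor_opp -{2}[x]tensor_scale1 -tensor_scaleDl addNr.
by rewrite -(trepr x) tcls_scale; exact/tclsP/teq_scale0.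
Qed.

HB.instance Definition _ := GRing.isZmodule.Build tensor
  tensor_addA tensor_addC tensor_add0 tensor_addN.
HB.instance Definition _ := GRing.Zmodule_isLmodule.Build k tensor
  tensor_scaleA tensor_scale1 tensor_scaleDr tensor_scaleDl.

Definition tens (v : V) (w : W) : tensor := tcls (TPure v w).

End TensorTerms.

Notation "V \ox W" := (tensor V W) (at level 40, left associativity) : type_scope.
Notation "v \ot w" := (tens v w) (at level 40, left associativity) : ring_scope.

Definition bilin (k : fieldType) (V W U : lmodType k) (f : V -> W -> U) : Prop :=
  (forall v, linear (f v)) /\ (forall w, linear (f^~ w)).

Section TensorMaps.
Variable k : fieldType.

Fixpoint tlift_term (V W U : lmodType k) (f : V -> W -> U) (t : tterm V W) : U :=
  match t with
  | TPure v w => f v w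
  | TZero => 0
  | TAdd s t => tlift_term f s + tlift_term f t
  | TScale a s => a *: tlift_term f s
  end.

(* The linear map induced by a bilinear map [f] (see [tlift_tens] and
   [tlift_linear]); meaningless when [f] is not bilinear. *)
Definition tlift (V W U : lmodType k) (f : V -> W -> U) (t : V \ox W) : U :=
  tlift_term f (repr t).

Lemma tens_bilin (V W : lmodType k) : bilin (@tens k V W).
Proof.
split=> [v a w w' | w a v v'] /=.
  rewrite /GRing.scale /GRing.add /= /tens tcls_scale tcls_add.
  apply/tclsP/(teq_trans (teq_pureDr _ _ _)).
  exact: teq_add (teq_pureZr _ _ _) (teq_refl _).
rewrite /GRing.scale /GRing.add /= /tens tcls_scale tcls_add.
apply/tclsP/(teq_trans (teq_pureDl _ _ _)).
exact: teq_add (teq_pureZl _ _ _) (teq_refl _).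
Qed.

Lemma tlift_term_teq (V W U : lmodType k) (f : V -> W -> U) (s t : tterm V W) :
  bilin f -> teq s t -> tlift_term f s = tlift_term f t.
Proof.
move=> [fr fl]; elim=> {s t} //=.
- by move=> t s u _ -> _ ->.
- by move=> s s' t t' _ -> _ ->.
- by move=> a s s' _ ->.
- by move=> s t u; rewrite addrA.
- by move=> s t; rewrite addrC.
- by move=> s; rewrite add0r.
- by move=> a b s; rewrite scalerA.
- by move=> s; rewrite scale0r.
- by move=> s; rewrite scale1r.
- by move=> a s t; rewrite scalerDr.
- by move=> a b s; rewrite scalerDl.
- by move=> v v' w; have := fl w 1 v v'; rewrite !scale1r.
- by move=> v w w'; have := fr v 1 w w'; rewrite !scale1r.
- move=> a v w; have f0 : f 0 w = 0.
    by have := fl w (-1) 0 0; rewrite !scaleN1r !addNr.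
  by have := fl w a v 0; rewrite !addr0 f0 addr0.
- move=> a v w; have f0 : f v 0 = 0.
    by have := fr v (-1) 0 0; rewrite !scaleN1r !addNr.
  by have := fr v a w 0; rewrite !addr0 f0 addr0.
Qed.

Lemma tlift_tens (V W U : lmodType k) (f : V -> W -> U) v w :
  bilin f -> tlift f (v \ot w) = f v w.
Proof. by move=> fB; rewrite /tlift (tlift_term_teq fB (trepr_eq _)). Qed.

Lemma tlift_linear (V W U : lmodType k) (f : V -> W -> U) :
  bilin f -> linear (tlift f).
Proof.
move=> fB a s t.
rewrite /tlift -[RHS]/(tlift_term f (TAdd (TScale a (repr s)) (repr t))).
apply: (tlift_term_teq fB); apply/tclsP; rewrite trepr.
by rewrite -tcls_add -tcls_scale !trepr.
Qed.

Definition tmap (V V' W W' : lmodType k) (f : V -> V') (g : W -> W') :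
    V \ox W -> V' \ox W' :=
  tlift (fun v w => f v \ot g w).

Definition tswap (V W : lmodType k) : V \ox W -> W \ox V :=
  tlift (fun v w => w \ot v).

Definition tassoc (V W U : lmodType k) : V \ox (W \ox U) -> (V \ox W) \ox U :=
  tlift (fun v => tlift (fun w u => (v \ot w) \ot u)).

Definition tcyc (V : lmodType k) : (V \ox V) \ox V -> (V \ox V) \ox V :=
  tlift (fun t c => tlift (fun a b => (b \ot c) \ot a) t).

Definition wedge (V : lmodType k) (a b : V) : V \ox V := a \ot b - b \ot a.

End TensorMaps.

Record subspace (k : fieldType) (V : lmodType k) := Subspace {
  sset : set V;
  subspace_closed :
    sset 0 /\ forall a x y, sset x -> sset y -> sset (a *: x + y) }.

Section SubspaceType.
Variables (k : fieldType) (V : lmodType k) (S : subspace V).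

Definition smem : {pred V} := fun x => `[< sset S x >].

Lemma smem_closed : submod_closed smem.
Proof.
have [S0 Slin] := subspace_closed S; split; first exact/asboolP.
by move=> a x y /asboolP Sx /asboolP Sy; apply/asboolP/Slin.
Qed.

HB.instance Definition _ := GRing.isSubmodClosed.Build k V smem smem_closed.

Definition subsp : Type := {x : V | smem x}.
HB.instance Definition _ := SubType.on subsp.
HB.instance Definition _ := [Choice of subsp by <:].
HB.instance Definition _ := [SubChoice_isSubLmodule of subsp by <:].

Definition sinj : subsp -> V := val.

End SubspaceType.

(* [corestr f v] is the preimage of [v] under an injective map [f] whose image
   contains [v] (and 0 if [v] has no preimage). *)
Definition corestr (k : fieldType) (U V : lmodType k) (f : U -> V) (v : V) : U :=
  xget 0 [set u | f u = v]%classic.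

Section LieBialgebras.
Variable k : fieldType.

Record is_lie_bracket (g : lmodType k) (br : g -> g -> g) : Prop := {
  lie_bilin : bilin br;
  lie_alt : forall x, br x x = 0;
  lie_jacobi : forall x y z, br x (br y z) + br y (br z x) + br z (br x y) = 0 }.

Record is_lie_cobracket (g : lmodType k) (cobr : g -> g \ox g) : Prop := {
  colie_lin : linear cobr;
  colie_anti : forall x, cobr x + tswap (cobr x) = 0;
  colie_jacobi : forall x, let t := tmap cobr id (cobr x) in
    t + tcyc t + tcyc (tcyc t) = 0 }.

(* The action of [x] on a tensor square; for [act] a Lie bracket this is
   ad_x (y (x) z) = [x, y] (x) z + y (x) [x, z]. *)
Definition tact (g V : lmodType k) (act : g -> V -> V) (x : g) (t : V \ox V) :
    V \ox V :=
  tmap (act x) id t + tmap id (act x) t.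

Record is_lie_bialgebra (g : lmodType k) (br : g -> g -> g)
    (cobr : g -> g \ox g) : Prop := {
  bialg_lie : is_lie_bracket br;
  bialg_colie : is_lie_cobracket cobr;
  bialg_cocycle : forall x y,
    cobr (br x y) = tact br x (cobr y) - tact br y (cobr x) }.

Record is_lie_bialgebra_iso (g g' : lmodType k)
    (br : g -> g -> g) (cobr : g -> g \ox g)
    (br' : g' -> g' -> g') (cobr' : g' -> g' \ox g') (phi : g -> g') : Prop := {
  iso_lin : linear phi;
  iso_bij : bijective phi;
  iso_br : forall x y, phi (br x y) = br' (phi x) (phi y);
  iso_cobr : forall x, tmap phi phi (cobr x) = cobr' (phi x) }.

Definition lie_bialgebra_isomorphic (g g' : lmodType k)
    (br : g -> g -> g) (cobr : g -> g \ox g)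
    (br' : g' -> g' -> g') (cobr' : g' -> g' \ox g') : Prop :=
  [/\ is_lie_bialgebra br cobr, is_lie_bialgebra br' cobr'
    & exists phi, is_lie_bialgebra_iso br cobr br' cobr' phi].

Record is_grading (g : lmodType k) (G : nat -> subspace g) : Prop := {
  grading_span : forall x, exists (N : nat) (s : forall n, subsp (G n)),
    x = \sum_(n < N) sinj (s n);
  grading_direct : forall (N : nat) (s : forall n, subsp (G n)),
    \sum_(n < N) sinj (s n) = 0 -> forall n : 'I_N, s n = 0 }.

Record is_graded_lie_bialgebra (g : lmodType k) (br : g -> g -> g)
    (cobr : g -> g \ox g) (G : nat -> subspace g) : Prop := {
  graded_bialg : is_lie_bialgebra br cobr;
  graded_sum : is_grading G;
  graded_br : forall m n x y,
    sset (G m) x -> sset (G n) y -> sset (G (m + n)%N) (br x y);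
  graded_cobr : forall n x, sset (G n) x ->
    exists t : forall i : 'I_n.+1, subsp (G i) \ox subsp (G (n - i)%N),
      cobr x = \sum_(i < n.+1) tmap (@sinj _ _ _) (@sinj _ _ _) (t i) }.

Definition sub_br (g : lmodType k) (br : g -> g -> g) (S : subspace g)
    (x y : subsp S) : subsp S :=
  corestr (@sinj _ _ S) (br (sinj x) (sinj y)).

Definition sub_cobr (g : lmodType k) (cobr : g -> g \ox g) (S : subspace g)
    (x : subsp S) : subsp S \ox subsp S :=
  corestr (tmap (@sinj _ _ S) (@sinj _ _ S)) (cobr (sinj x)).

End LieBialgebras.

Section CrossedModules.
Variables (k : fieldType) (f : lmodType k).
Variables (br : f -> f -> f) (cobr : f -> f \ox f).

Record is_lie_crossed_module (V : lmodType k) (act : f -> V -> V)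
    (coact : V -> f \ox V) : Prop := {
  crossed_base : is_lie_bialgebra br cobr;
  crossed_act_bilin : bilin act;
  crossed_act : forall xi eta v,
    act (br xi eta) v = act xi (act eta v) - act eta (act xi v);
  crossed_coact_lin : linear coact;
  crossed_coact : forall v,
    let t := tassoc (tmap id coact (coact v)) in
    tmap cobr id (coact v) = t - tmap (@tswap _ _ _) id t;
  crossed_compat : forall xi v,
    coact (act xi v) =
      tmap (br xi) id (coact v) + tmap id (act xi) (coact v)
      + tmap id (act^~ v) (cobr xi) }.

Definition tcoact (V : lmodType k) (coact : V -> f \ox V) :
    V \ox V -> f \ox (V \ox V) :=
  tlift (fun v w => tmap id (fun v2 => v2 \ot w) (coact v)
                    + tmap id (fun w2 => v \ot w2) (coact w)).

(* For beta(w) = w1 (x) w2, [half_braiding v w] is w1.v (x) w2, so that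
   psi(v (x) w) = h(v, w) - h(w, v) - tau h(v, w) + tau h(w, v). *)
Definition half_braiding (V : lmodType k) (act : f -> V -> V)
    (coact : V -> f \ox V) (v w : V) : V \ox V :=
  tmap (act^~ v) id (coact w).

Definition inf_braiding (V : lmodType k) (act : f -> V -> V)
    (coact : V -> f \ox V) : V \ox V -> V \ox V :=
  tlift (fun v w =>
    half_braiding act coact v w - half_braiding act coact w v
    - tswap (half_braiding act coact v w)
    + tswap (half_braiding act coact w v)).

Record is_braided_lie_bialgebra (b : lmodType k) (act : f -> b -> b)
    (coact : b -> f \ox b) (bbr : b -> b -> b) (bcobr : b -> b \ox b) : Prop := {
  braided_crossed : is_lie_crossed_module act coact;
  braided_lie : is_lie_bracket bbr;
  braided_colie : is_lie_cobracket bcobr;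
  braided_br_mod : forall xi x y,
    act xi (bbr x y) = bbr (act xi x) y + bbr x (act xi y);
  braided_br_comod : forall x y,
    coact (bbr x y) = tmap id (tlift bbr) (tcoact coact (x \ot y));
  braided_cobr_mod : forall xi x, bcobr (act xi x) = tact act xi (bcobr x);
  braided_cobr_comod : forall x,
    tmap id bcobr (coact x) = tcoact coact (bcobr x);
  braided_cocycle : forall x y,
    bcobr (bbr x y) = tact bbr x (bcobr y) - tact bbr y (bcobr x)
                      - inf_braiding act coact (x \ot y) }.

Definition boson_br (b : lmodType k) (act : f -> b -> b) (bbr : b -> b -> b)
    (p q : (b * f)%type) : (b * f)%type :=
  (bbr p.1 q.1 + act p.2 q.1 - act q.2 p.1, br p.2 q.2).

Definition boson_cobr (b : lmodType k) (coact : b -> f \ox b)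
    (bcobr : b -> b \ox b) (p : (b * f)%type) : (b * f)%type \ox (b * f)%type :=
  let inb (x : b) : (b * f)%type := (x, 0) in
  let inf (xi : f) : (b * f)%type := (0, xi) in
  tmap inb inb (bcobr p.1) + tmap inf inb (coact p.1)
  - tmap inb inf (tswap (coact p.1)) + tmap inf inf (cobr p.2).

End CrossedModules.

Record is_gcm (I : finType) (C : I -> I -> int) : Prop := {
  gcm_diag : forall i, C i i = 2;
  gcm_off : forall i j, i != j -> C i j <= 0;
  gcm_zero : forall i j, C i j = 0 -> C j i = 0 }.

Definition is_symmetrizer (k : fieldType) (I : finType) (C : I -> I -> int)
    (d : I -> k) : Prop :=
  (forall i, d i != 0) /\
  (forall i j, d i * (C i j)%:~R = d j * (C j i)%:~R).

Definition gcm_rank (I : finType) (C : I -> I -> int) : nat :=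
  \rank (\matrix_(i < #|I|, j < #|I|) (C (enum_val i) (enum_val j))%:~R
         : 'M[rat]_(#|I|)).

Record root_datum (k : fieldType) (I : finType) := RootDatum {
  cartan : I -> I -> int;
  rd_H : vectType k;
  rd_h : I -> rd_H;
  rd_alpha : I -> 'Hom(rd_H, k^o);
  rd_gcm : is_gcm cartan;
  rd_dim : \dim {: rd_H} = (2 * #|I| - gcm_rank cartan)%N;
  rd_h_free : free [seq rd_h i | i <- enum I];
  rd_alpha_free : free [seq rd_alpha i | i <- enum I];
  rd_pairing : forall i j, rd_alpha j (rd_h i) = (cartan i j)%:~R }.

Definition is_sub_root_datum (k : fieldType) (I J : finType)
    (D' : root_datum k J) (D : root_datum k I) (iota : J -> I) : Prop :=
  [/\ injective iota,
      forall i j, cartan D' i j = cartan D (iota i) (iota j)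
    & exists s : 'Hom(rd_H D', rd_H D),
        [/\ injective s,
            forall i, s (rd_h D' i) = rd_h D (iota i)
          & forall i x, rd_alpha D (iota i) (s x) = rd_alpha D' i x]].

Section KacMoody.
Variables (k : fieldType) (I : finType) (D : root_datum k I).

(* Lie words in the generators; L(C) is their quotient by the least congruence
   containing the Lie algebra axioms, linearity in H and the defining
   relations. *)
Inductive km_term : Type :=
| KH of rd_H D
| KE of I
| KF of I
| KZero
| KAdd of km_term & km_term
| KScale of k & km_term
| KBr of km_term & km_term.

Inductive km_eq : km_term -> km_term -> Prop :=
| km_refl s : km_eq s s
| km_sym s t : km_eq s t -> km_eq t s
| km_trans t s u : km_eq s t -> km_eq t u -> km_eq s u
| km_add_congr s s' t t' :
    km_eq s s' -> km_eq t t' -> km_eq (KAdd s t) (KAdd s' t')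
| km_scale_congr a s s' : km_eq s s' -> km_eq (KScale a s) (KScale a s')
| km_br_congr s s' t t' :
    km_eq s s' -> km_eq t t' -> km_eq (KBr s t) (KBr s' t')
| km_addA s t u : km_eq (KAdd s (KAdd t u)) (KAdd (KAdd s t) u)
| km_addC s t : km_eq (KAdd s t) (KAdd t s)
| km_add0 s : km_eq (KAdd KZero s) s
| km_scaleA a b s : km_eq (KScale a (KScale b s)) (KScale (a * b) s)
| km_scale0 s : km_eq (KScale 0 s) KZero
| km_scale1 s : km_eq (KScale 1 s) s
| km_scaleDr a s t : km_eq (KScale a (KAdd s t)) (KAdd (KScale a s) (KScale a t))
| km_scaleDl a b s : km_eq (KScale (a + b) s) (KAdd (KScale a s) (KScale b s))
| km_brDl s s' t : km_eq (KBr (KAdd s s') t) (KAdd (KBr s t) (KBr s' t))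
| km_brDr s t t' : km_eq (KBr s (KAdd t t')) (KAdd (KBr s t) (KBr s t'))
| km_brZl a s t : km_eq (KBr (KScale a s) t) (KScale a (KBr s t))
| km_brZr a s t : km_eq (KBr s (KScale a t)) (KScale a (KBr s t))
| km_br_alt s : km_eq (KBr s s) KZero
| km_br_jacobi s t u :
    km_eq (KAdd (KAdd (KBr s (KBr t u)) (KBr t (KBr u s))) (KBr u (KBr s t)))
          KZero
| km_H_lin a x y : km_eq (KH (a *: x + y)) (KAdd (KScale a (KH x)) (KH y))
| km_HH x y : km_eq (KBr (KH x) (KH y)) KZero
| km_EF_diag i : km_eq (KBr (KE i) (KF i)) (KH (rd_h D i))
| km_EF_off i j : i != j -> km_eq (KBr (KE i) (KF j)) KZero
| km_HE x i : km_eq (KBr (KH x) (KE i)) (KScale (rd_alpha D i x : k) (KE i))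
| km_HF x i : km_eq (KBr (KH x) (KF i)) (KScale (- (rd_alpha D i x : k)) (KF i))
(* C i j <= 0 for i != j, so that the absolute value is 1 - C i j itself *)
| km_serreE i j : i != j ->
    km_eq (iter `|(1 - cartan D i j)%R|%N (KBr (KE i)) (KE j)) KZero
| km_serreF i j : i != j ->
    km_eq (iter `|(1 - cartan D i j)%R|%N (KBr (KF i)) (KF j)) KZero.

HB.instance Definition _ := gen_eqMixin km_term.
HB.instance Definition _ := gen_choiceMixin km_term.

Definition km_eqb (s t : km_term) : bool := `[< km_eq s t >].

Lemma km_eqb_refl : reflexive km_eqb.
Proof. by move=> s; apply/asboolP/km_refl. Qed.
Lemma km_eqb_sym : symmetric km_eqb.
Proof. by move=> s t; apply/asboolP/asboolP; apply: km_sym. Qed.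
Lemma km_eqb_trans : transitive km_eqb.
Proof.
by move=> t s u /asboolP st /asboolP tu; apply/asboolP/(km_trans st tu).
Qed.

Canonical km_eqb_equiv := EquivRel km_eqb km_eqb_refl km_eqb_sym km_eqb_trans.

Definition km_algebra := {eq_quot km_eqb}.
HB.instance Definition _ := Choice.on km_algebra.
HB.instance Definition _ := EqQuotient.on km_algebra.

Definition km_cls (s : km_term) : km_algebra := \pi_km_algebra s.

Lemma km_clsP s t : km_cls s = km_cls t <-> km_eq s t.
Proof.
split; first by move/eqmodP => /asboolP.
by move=> st; apply/eqmodP/asboolP.
Qed.

Lemma km_repr (x : km_algebra) : km_cls (repr x) = x.
Proof. exact: reprK. Qed.

Lemma km_repr_eq s : km_eq (repr (km_cls s)) s.
Proof. by apply/km_clsP; rewrite km_repr. Qed.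

Definition km_zero : km_algebra := km_cls KZero.
Definition km_add (x y : km_algebra) : km_algebra :=
  km_cls (KAdd (repr x) (repr y)).
Definition km_scale a (x : km_algebra) : km_algebra := km_cls (KScale a (repr x)).
Definition km_opp (x : km_algebra) : km_algebra := km_scale (-1) x.
Definition km_br (x y : km_algebra) : km_algebra := km_cls (KBr (repr x) (repr y)).

Lemma km_cls_add s t : km_add (km_cls s) (km_cls t) = km_cls (KAdd s t).
Proof. by apply/km_clsP/km_add_congr; exact: km_repr_eq. Qed.
Lemma km_cls_scale a s : km_scale a (km_cls s) = km_cls (KScale a s).
Proof. by apply/km_clsP/km_scale_congr; exact: km_repr_eq. Qed.
Lemma km_cls_br s t : km_br (km_cls s) (km_cls t) = km_cls (KBr s t).
Proof. by apply/km_clsP/km_br_congr; exact: km_repr_eq. Qed.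

Lemma km_algebra_addA : associative km_add.
Proof.
move=> x y z; rewrite -(km_repr x) -(km_repr y) -(km_repr z) !km_cls_add.
exact/km_clsP/km_addA.
Qed.
Lemma km_algebra_addC : commutative km_add.
Proof.
move=> x y; rewrite -(km_repr x) -(km_repr y) !km_cls_add.
exact/km_clsP/km_addC.
Qed.
Lemma km_algebra_add0 : left_id km_zero km_add.
Proof. by move=> x; rewrite -(km_repr x) km_cls_add; exact/km_clsP/km_add0. Qed.
Lemma km_algebra_scaleA a b x : km_scale a (km_scale b x) = km_scale (a * b) x.
Proof. by rewrite -(km_repr x) !km_cls_scale; exact/km_clsP/km_scaleA. Qed.
Lemma km_algebra_scale1 : left_id 1 km_scale.
Proof. by move=> x; rewrite -(km_repr x) km_cls_scale; exact/km_clsP/km_scale1. Qed.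
Lemma km_algebra_scaleDr : right_distributive km_scale km_add.
Proof.
move=> a x y; rewrite -(km_repr x) -(km_repr y) !(km_cls_add, km_cls_scale).
exact/km_clsP/km_scaleDr.
Qed.
Lemma km_algebra_scaleDl x a b :
  km_scale (a + b) x = km_add (km_scale a x) (km_scale b x).
Proof.
by rewrite -(km_repr x) !(km_cls_add, km_cls_scale); exact/km_clsP/km_scaleDl.
Qed.
Lemma km_algebra_addN : left_inverse km_zero km_opp km_add.
Proof.
move=> x; rewrite /km_opp -{2}[x]km_algebra_scale1 -km_algebra_scaleDl addNr.
by rewrite -(km_repr x) km_cls_scale; exact/km_clsP/km_scale0.
Qed.

HB.instance Definition _ := GRing.isZmodule.Build km_algebra
  km_algebra_addA km_algebra_addC km_algebra_add0 km_algebra_addN.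
HB.instance Definition _ := GRing.Zmodule_isLmodule.Build k km_algebra
  km_algebra_scaleA km_algebra_scale1 km_algebra_scaleDr km_algebra_scaleDl.

Definition km_H (x : rd_H D) : km_algebra := km_cls (KH x).
Definition km_e (i : I) : km_algebra := km_cls (KE i).
Definition km_f (i : I) : km_algebra := km_cls (KF i).

Lemma km_is_lie : is_lie_bracket km_br.
Proof.
have clsE s t : km_cls s + km_cls t = km_cls (KAdd s t) by exact: km_cls_add.
have clsZ a s : a *: km_cls s = km_cls (KScale a s) by exact: km_cls_scale.
split.
- split=> [x a y z | z a x y].
    rewrite -(km_repr x) -(km_repr y) -(km_repr z) clsZ clsE.
    rewrite 3!km_cls_br clsZ clsE; apply/km_clsP.
    apply: km_trans (km_brDr _ _ _) _.
    exact: km_add_congr (km_brZr _ _ _) (km_refl _).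
  rewrite -(km_repr x) -(km_repr y) -(km_repr z) clsZ clsE.
  rewrite 3!km_cls_br clsZ clsE; apply/km_clsP.
  apply: km_trans (km_brDl _ _ _) _.
  exact: km_add_congr (km_brZl _ _ _) (km_refl _).
- move=> x; rewrite -(km_repr x) km_cls_br; exact/km_clsP/km_br_alt.
- move=> x y z; rewrite -(km_repr x) -(km_repr y) -(km_repr z).
  rewrite 6!km_cls_br [X in X + _]clsE clsE; exact/km_clsP/km_br_jacobi.
Qed.

(* The Kac-Moody cobracket for the symmetrizer [d], by recursion on Lie words:
   the prescribed values on generators, extended by the cocycle condition.  The
   recursion respects [km_eq], so [km_cobr] does not depend on the choice of
   representative. *)
Fixpoint km_cobr_term (d : I -> k) (t : km_term) : km_algebra \ox km_algebra :=
  match t with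
  | KH x => 0
  | KE i => (d i / 2%:R) *: wedge (km_e i) (km_H (rd_h D i))
  | KF i => (d i / 2%:R) *: wedge (km_f i) (km_H (rd_h D i))
  | KZero => 0
  | KAdd s t => km_cobr_term d s + km_cobr_term d t
  | KScale a s => a *: km_cobr_term d s
  | KBr s t => tact km_br (km_cls s) (km_cobr_term d t)
               - tact km_br (km_cls t) (km_cobr_term d s)
  end.

Definition km_cobr (d : I -> k) (x : km_algebra) : km_algebra \ox km_algebra :=
  km_cobr_term d (repr x).

Inductive in_borel : km_algebra -> Prop :=
| borel_H x : in_borel (km_H x)
| borel_f i : in_borel (km_f i)
| borel_0 : in_borel 0
| borel_lin a x y : in_borel x -> in_borel y -> in_borel (a *: x + y)
| borel_br x y : in_borel x -> in_borel y -> in_borel (km_br x y).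

Definition borel : subspace km_algebra :=
  @Subspace k km_algebra in_borel (conj borel_0 borel_lin).

Definition borel_bracket : subsp borel -> subsp borel -> subsp borel :=
  sub_br km_br (S := borel).

Definition borel_cobracket (d : I -> k) :
    subsp borel -> subsp borel \ox subsp borel :=
  sub_cobr (km_cobr d) (S := borel).

(* For degrees [deg i] of the f_i and degree 0 of H, the span of the iterated
   brackets of generators of total degree [n]. *)
Inductive in_borel_deg (deg : I -> nat) : nat -> km_algebra -> Prop :=
| borel_deg_H x : in_borel_deg deg 0 (km_H x)
| borel_deg_f i : in_borel_deg deg (deg i) (km_f i)
| borel_deg_0 n : in_borel_deg deg n 0
| borel_deg_lin n a x y :
    in_borel_deg deg n x -> in_borel_deg deg n y ->
    in_borel_deg deg n (a *: x + y)
| borel_deg_br m n x y :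
    in_borel_deg deg m x -> in_borel_deg deg n y ->
    in_borel_deg deg (m + n) (km_br x y).

Definition borel_graded_set (deg : I -> nat) (n : nat) : set (subsp borel) :=
  [set x | in_borel_deg deg n (sinj x)]%classic.

Lemma borel_graded_closed deg n :
  borel_graded_set deg n 0 /\
  forall a x y, borel_graded_set deg n x -> borel_graded_set deg n y ->
    borel_graded_set deg n (a *: x + y).
Proof. by split=> [|a x y Bx By]; [exact: borel_deg_0 | exact: borel_deg_lin]. Qed.

Definition borel_graded (deg : I -> nat) (n : nat) : subspace (subsp borel) :=
  Subspace (borel_graded_closed deg n).

End KacMoody.

Section SubRootDatum.
Variables (k : fieldType) (I J : finType) (D : root_datum k I) (iota : J -> I).

Definition srd_deg (i : I) : nat := i \notin codom iota.

Definition srd_grading : nat -> subspace (subsp (borel D)) :=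
  borel_graded D srd_deg.

Definition B0 : subspace (subsp (borel D)) := srd_grading 0.

Definition b_set : set (subsp (borel D)) :=
  [set x | exists (N : nat) (s : forall n, subsp (srd_grading n.+1)),
     x = \sum_(n < N) sinj (s n)]%classic.

Lemma b_closed :
  b_set 0 /\ forall a x y, b_set x -> b_set y -> b_set (a *: x + y).
Proof.
split; first by exists 0%N, (fun _ => 0); rewrite big_ord0.
move=> a _ _ [N [s ->]] [M [t ->]].
pose trunc (P : nat) (u : forall n, subsp (srd_grading n.+1)) :
    forall n, subsp (srd_grading n.+1) :=
  fun n => if (n < P)%N then u n else 0.
have truncE P (u : forall n, subsp (srd_grading n.+1)) :
    (P <= maxn N M)%N ->
    \sum_(n < P) sinj (u n) = \sum_(n < maxn N M) sinj (trunc P u n).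
  move=> leP; rewrite (big_ord_widen _ (fun n => sinj (u n)) leP) big_mkcond /=.
  by apply: eq_bigr => n _; rewrite /trunc; case: ifP.
exists (maxn N M), (fun n => a *: trunc N s n + trunc M t n).
rewrite (truncE N s (leq_maxl N M)) (truncE M t (leq_maxr N M)) scaler_sumr -big_split /=.
by apply: eq_bigr => n _.
Qed.

Definition b_srd : subspace (subsp (borel D)) := Subspace b_closed.

(* The projection pi: as B^- is the direct sum of [B0] and [b_srd], [B0_proj x]
   is the unique [y] in [B0] such that [x - y] lies in [b_srd]. *)
Definition B0_proj (x : subsp (borel D)) : subsp B0 :=
  xget 0 [set y : subsp B0 | sset b_srd (x - sinj y)]%classic.

Definition b_proj (x : subsp (borel D)) : subsp b_srd :=
  corestr (@sinj _ _ b_srd) (x - sinj (B0_proj x)).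

Definition B0_br : subsp B0 -> subsp B0 -> subsp B0 :=
  sub_br (@borel_bracket k I D) (S := B0).

Definition b_br : subsp b_srd -> subsp b_srd -> subsp b_srd :=
  sub_br (@borel_bracket k I D) (S := b_srd).

Definition b_act (xi : subsp B0) (x : subsp b_srd) : subsp b_srd :=
  corestr (@sinj _ _ b_srd) (borel_bracket (sinj xi) (sinj x)).

Variable d : I -> k.

Definition B0_cobr : subsp B0 -> subsp B0 \ox subsp B0 :=
  sub_cobr (@borel_cobracket k I D d) (S := B0).

Definition b_coact (x : subsp b_srd) : subsp B0 \ox subsp b_srd :=
  corestr (tmap id (@sinj _ _ b_srd))
          (tmap B0_proj id (borel_cobracket d (sinj x))).

Definition b_cobr (x : subsp b_srd) : subsp b_srd \ox subsp b_srd :=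
  tmap b_proj b_proj (borel_cobracket d (sinj x)).

End SubRootDatum.

Arguments borel_bracket {k I} D.
Arguments borel_cobracket {k I} D d.
Arguments B0_br {k I J} D iota.
Arguments B0_cobr {k I J} D iota d.
Arguments b_br {k I J} D iota.
Arguments b_act {k I J} D iota.
Arguments b_coact {k I J} D iota d.
Arguments b_cobr {k I J} D iota d.

(* Main.v *)
Require Import Defs.
From HB Require Import structures.
From mathcomp Require Import all_boot all_order all_algebra.
From mathcomp Require Import boolp classical_sets.
From mathcomp Require Import ring zify.

(** A map [tmap f h] with [f] and [h] split injective is injective, so the axioms
    of a Lie bialgebra pass to any space that embeds compatibly into one; this
    gives [B^-] from [L(C)], [B^-_0] from [B^-], and the bosonisation, which maps
    onto [B^-], at once.  For [L(C)] itself, the cobracket respects the Serre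
    relations by the closed formula [serre_cobrE], whose coefficients vanish at
    exponent [1 - C i j], and the failure of co-Jacobi is a 1-cocycle that
    vanishes on the generators.  As the roots are free, some [h] in [H] acts on
    degree [n] by the scalar [n], which makes the grading direct in
    characteristic 0.  Each axiom of a braided-Lie bialgebra is the image of an
    axiom of [B^-] under tensor products of the projections onto [B^-_0] and
    [b]; the braiding collects the mixed terms of the cocycle condition. *)

Set Implicit Arguments.
Unset Strict Implicit.
Unset Printing Implicit Defensive.

Import GRing.Theory.
Local Open Scope ring_scope.

(** The tensor product is a quotient of formal expressions and comes without bases, so even the
    injectivity of the tensor square of an inclusion has to be earned: a complement from Zorn's
    lemma gives a linear retraction, and [tmap] of retractions is a left inverse. The retraction
    respects no bracket; it serves injectivity only. Most operations on the subspaces are preimages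
    chosen by [corestr], so nothing, not even linearity, is known about them before the values are
    shown to lie in the right image. For the cobracket of $B^-$ this comes from a graded statement:
    a cobracket in degree n is a sum of tensors of homogeneous elements of degrees adding up to n.
    Bosonisation works because a positive degree is never a sum of two zeros: the projection to
    degree 0 is then a Lie bialgebra morphism split by the inclusion. Any such split projection is
    treated at once, as in Radford's theorem on Hopf algebras with a projection. *)

(** * Reflexive comparison of linear combinations in a module *)

Section LinearCombinations.
Variables (k : fieldType) (V : lmodType k).

Inductive lexp : Type :=
| LVar of nat
| LZero
| LAdd of lexp & lexp
| LOpp of lexp
| LScale of k & lexp.

Fixpoint ldenote (env : seq V) (e : lexp) : V :=
  match e with
  | LVar n => nth 0 env n
  | LZero => 0
  | LAdd e1 e2 => ldenote env e1 + ldenote env e2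
  | LOpp e1 => - ldenote env e1
  | LScale a e1 => a *: ldenote env e1
  end.

(** [Nat.eqb] instead of [==] lets [cbn] decide the test on numerals, so that only scalar identities
    are left for [ring]. *)
Fixpoint lcoef (i : nat) (e : lexp) : k :=
  match e with
  | LVar n => if Nat.eqb n i then 1 else 0
  | LZero => 0
  | LAdd e1 e2 => lcoef i e1 + lcoef i e2
  | LOpp e1 => - lcoef i e1
  | LScale a e1 => a * lcoef i e1
  end.

Fixpoint lcoef_eq (n : nat) (e1 e2 : lexp) : Prop :=
  match n with
  | 0 => True
  | n'.+1 => lcoef n' e1 = lcoef n' e2 /\ lcoef_eq n' e1 e2
  end.

Lemma ldenoteE env e : ldenote env e = \sum_(i < size env) lcoef i e *: nth 0 env i.
Proof.
elim: e => [n||e1 IH1 e2 IH2|e1 IH1|a e1 IH1] /=.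
- have [lt_n|ge_n] := ltnP n (size env); last first.
    rewrite nth_default // big1 // => i _; case: PeanoNat.Nat.eqb_spec => [n_i|_].
      by move: ge_n; rewrite n_i leqNgt ltn_ord.
    exact: scale0r.
  rewrite (bigD1 (Ordinal lt_n)) //= PeanoNat.Nat.eqb_refl scale1r big1 ?addr0 // => i ne.
  case: PeanoNat.Nat.eqb_spec => [n_i|_]; last exact: scale0r.
  by case/eqP: ne; apply: val_inj.
- by rewrite big1 // => i _; rewrite scale0r.
- by rewrite IH1 IH2 -big_split; apply: eq_bigr => i _; rewrite scalerDl.
- by rewrite IH1 -sumrN; apply: eq_bigr => i _; rewrite scaleNr.
- by rewrite IH1 scaler_sumr; apply: eq_bigr => i _; rewrite scalerA.
Qed.

Lemma lexp_eq env e1 e2 : lcoef_eq (size env) e1 e2 -> ldenote env e1 = ldenote env e2.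
Proof.
move=> E; rewrite !ldenoteE; apply: eq_bigr => i _; congr (_ *: _).
elim: (size env) i E => [[]//|n IHn] i [En E'].
have := ltn_ord i; have [->//|ne] := eqVneq (i : nat) n => lt_i.
apply: (IHn (Ordinal (_ : i < n)%N)) => //.
by rewrite ltn_neqAle ne.
Qed.

End LinearCombinations.

Ltac lmem x l :=
  lazymatch l with
  | nil => constr:(false)
  | x :: _ => constr:(true)
  | _ :: ?l' => lmem x l'
  end.

Ltac latoms t l :=
  lazymatch t with
  | @GRing.add _ ?a ?b => let l' := latoms a l in latoms b l'
  | @GRing.opp _ ?a => latoms a l
  | @GRing.scale _ _ _ ?a => latoms a l
  | @GRing.zero _ => l
  | _ => let m := lmem t l in
    lazymatch m with true => l | false => constr:(t :: l) end
  end.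

Ltac lindex x l :=
  lazymatch l with
  | x :: _ => constr:(0%N)
  | _ :: ?l' => let n := lindex x l' in constr:(S n)
  end.

Ltac lreify k t l :=
  lazymatch t with
  | @GRing.add _ ?a ?b =>
    let a' := lreify k a l in let b' := lreify k b l in constr:(@LAdd k a' b')
  | @GRing.opp _ ?a => let a' := lreify k a l in constr:(@LOpp k a')
  | @GRing.scale _ _ ?c ?a => let a' := lreify k a l in constr:(@LScale k c a')
  | @GRing.zero _ => constr:(@LZero k)
  | _ => let n := lindex t l in constr:(@LVar k n)
  end.

(* Decides an identity between linear combinations in a module by comparing
   the coefficients of each atom with [ring]. *)
Tactic Notation "lmod" constr(k) :=
  unfold reverse_coercion;
  lazymatch goal with
  | |- @eq ?T ?u ?v =>
    let l := latoms u (@nil T) in let l := latoms v l in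
    let eu := lreify k u l in let ev := lreify k v l in
    apply: (@lexp_eq k _ l eu ev);
    cbn [size lcoef_eq lcoef Nat.eqb]; repeat split; try ring
  end.

(** * Induced linear maps on tensor products *)

Section Tensors.
Variable k : fieldType.
Implicit Types V W U : lmodType k.

Lemma tens_linl V W (w : W) : linear (fun v : V => v \ot w).
Proof. exact: (tens_bilin V W).2. Qed.

Lemma tens_linr V W (v : V) : linear (fun w : W => v \ot w).
Proof. exact: (tens_bilin V W).1. Qed.

HB.instance Definition _ V W (v : V) :=
  GRing.isLinear.Build k W (V \ox W) *:%R (@tens k V W v) (@tens_linr V W v).

Lemma tens0r V W (v : V) : v \ot (0 : W) = 0.
Proof. exact: linear0. Qed.

Lemma tensDl V W (v v' : V) (w : W) : (v + v') \ot w = v \ot w + v' \ot w.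
Proof. by have := tens_linl w 1 v v'; rewrite !scale1r. Qed.

Lemma tensDr V W (v : V) (w w' : W) : v \ot (w + w') = v \ot w + v \ot w'.
Proof. exact: linearD. Qed.

Lemma tens0l V W (w : W) : (0 : V) \ot w = 0.
Proof. by apply: (addIr (0 \ot w)); rewrite -tensDl !add0r. Qed.

Lemma tensZl V W a (v : V) (w : W) : (a *: v) \ot w = a *: (v \ot w).
Proof. by have := tens_linl w a v 0; rewrite !addr0 tens0l addr0. Qed.

Lemma tensZr V W a (v : V) (w : W) : v \ot (a *: w) = a *: (v \ot w).
Proof. exact: linearZ. Qed.

Lemma tensNl V W (v : V) (w : W) : (- v) \ot w = - (v \ot w).
Proof. by rewrite -scaleN1r tensZl scaleN1r. Qed.

Lemma tensNr V W (v : V) (w : W) : v \ot (- w) = - (v \ot w).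
Proof. exact: linearN. Qed.

(** Induction on a formal expression that represents the tensor. *)
Lemma tensor_ind V W (P : V \ox W -> Prop) :
  P 0 -> (forall a s t, P s -> P t -> P (a *: s + t)) ->
  (forall v w, P (v \ot w)) -> forall t, P t.
Proof.
move=> P0 Plin Ppure t; rewrite -(trepr t); elim: (repr t) => {t} //=.
- move=> s Ps t Pt; have -> : tcls (TAdd s t) = 1 *: tcls s + tcls t.
    by rewrite scale1r -tcls_add.
  exact: Plin.
- move=> a s Ps; have -> : tcls (TScale a s) = a *: tcls s + 0 by rewrite addr0 -tcls_scale.
  exact: Plin.
Qed.

Lemma tens_ext V W U (f g : {linear V \ox W -> U}) :
  (forall v w, f (v \ot w) = g (v \ot w)) -> f =1 g.
Proof.
move=> fg; apply: tensor_ind => [|a s t fs ft|//]; first by rewrite !linear0.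
by rewrite !linearP fs ft.
Qed.

Lemma tmap_bilin V V' W W' (f : {linear V -> V'}) (g : {linear W -> W'}) :
  bilin (fun v w => f v \ot g w).
Proof.
by split=> [v a w w' | w a v v'] /=; rewrite linearP ?tens_linl ?linearP.
Qed.

HB.instance Definition _ V V' W W' (f : {linear V -> V'}) (g : {linear W -> W'}) :=
  GRing.isLinear.Build k (V \ox W) (V' \ox W') *:%R (tmap f g)
    (tlift_linear (tmap_bilin f g)).

Lemma tmapE V V' W W' (f : {linear V -> V'}) (g : {linear W -> W'}) v w :
  tmap f g (v \ot w) = f v \ot g w.
Proof. exact: tlift_tens (tmap_bilin f g). Qed.

Lemma tswap_bilin V W : bilin (fun (v : V) (w : W) => w \ot v).
Proof. by split=> [v|w]; [exact: tens_linl | exact: tens_linr]. Qed.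

HB.instance Definition _ V W :=
  GRing.isLinear.Build k (V \ox W) (W \ox V) *:%R (@tswap k V W)
    (tlift_linear (tswap_bilin V W)).

Lemma tswapE V W (v : V) (w : W) : tswap (v \ot w) = w \ot v.
Proof. exact: tlift_tens (tswap_bilin V W). Qed.

(** [tassoc] and [tcyc] nest one lift inside another, and the outer lift makes sense only if the
    inner one is linear in the outer variable. *)
Lemma tlift_bilin_family (X : lmodType k) V W U (F : X -> V -> W -> U) :
  (forall x, bilin (F x)) -> (forall v w, linear (fun x => F x v w)) ->
  forall t, linear (fun x => tlift (F x) t).
Proof.
move=> FB Flin; apply: tensor_ind => [|b s t IHs IHt|v w] a x y /=.
- have F0 z : tlift (F z) 0 = 0.
    by have := tlift_linear (FB z) (-1) 0 0; rewrite !scaleN1r !addNr.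
  by rewrite !F0 scaler0 addr0.
- have FP z := tlift_linear (FB z) b s t.
  by rewrite !FP IHs IHt !scalerDr !scalerA [b * a]mulrC addrACA.
- by rewrite !(tlift_tens _ _ (FB _)) Flin.
Qed.

Lemma tassoc_bilin1 V W U (v : V) : bilin (fun (w : W) (u : U) => (v \ot w) \ot u).
Proof.
split=> [w|u a w w'] /=; first exact: tens_linr.
by rewrite linearP /= tens_linl.
Qed.

Lemma tassoc_bilin V W U :
  bilin (fun v : V => tlift (fun (w : W) (u : U) => (v \ot w) \ot u)).
Proof.
split=> [v|t] /=; first exact: (tlift_linear (@tassoc_bilin1 V W U v)).
apply: tlift_bilin_family => [v|w u a v v']; first exact: tassoc_bilin1.
by rewrite !tens_linl.
Qed.

HB.instance Definition _ V W U :=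
  GRing.isLinear.Build k (V \ox (W \ox U)) ((V \ox W) \ox U) *:%R (@tassoc k V W U)
    (tlift_linear (tassoc_bilin V W U)).

Lemma tassocE V W U (v : V) (w : W) (u : U) :
  tassoc (v \ot (w \ot u)) = (v \ot w) \ot u.
Proof.
by rewrite /tassoc (tlift_tens _ _ (tassoc_bilin V W U)) (tlift_tens _ _ (@tassoc_bilin1 V W U v)).
Qed.

Lemma tcyc_bilin1 V (c : V) : bilin (fun a b : V => (b \ot c) \ot a).
Proof.
split=> [a x b b'|b]; last exact: tens_linr.
by rewrite !tens_linl.
Qed.

Lemma tcyc_bilin V :
  bilin (fun (t : V \ox V) (c : V) => tlift (fun a b => (b \ot c) \ot a) t).
Proof.
split=> [t|c] /=; last exact: (tlift_linear (@tcyc_bilin1 V c)).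
apply: tlift_bilin_family => [c|a b x c c']; first exact: tcyc_bilin1.
by rewrite linearP /= tens_linl.
Qed.

HB.instance Definition _ V :=
  GRing.isLinear.Build k ((V \ox V) \ox V) ((V \ox V) \ox V) *:%R (@tcyc k V)
    (tlift_linear (tcyc_bilin V)).

Lemma tcycE V (a b c : V) : tcyc ((a \ot b) \ot c) = (b \ot c) \ot a.
Proof.
by rewrite /tcyc (tlift_tens _ _ (tcyc_bilin V)) (tlift_tens _ _ (@tcyc_bilin1 V c)).
Qed.

End Tensors.

(** * Complements and retractions of subspaces *)

Section Retraction.
Variables (k : fieldType) (V : lmodType k) (S : subspace V).

Lemma sinj_is_linear : linear (@sinj k V S).
Proof. by []. Qed.

HB.instance Definition _ :=
  GRing.isLinear.Build k (subsp S) V *:%R (@sinj k V S) sinj_is_linear.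

Lemma sinj_inj : injective (@sinj k V S).
Proof. exact: val_inj. Qed.

Lemma sinjP (x : subsp S) : sset S (sinj x).
Proof. by case: x => v Sv; apply/asboolP. Qed.

Lemma sinj_surj v : sset S v -> exists x : subsp S, sinj x = v.
Proof. by move=> /asboolP Sv; exists (exist _ v Sv). Qed.

Lemma corestrK (U W : lmodType k) (f : U -> W) v :
  (exists u, f u = v) -> f (corestr f v) = v.
Proof. exact: (@xgetPex _ 0 [set u | f u = v]%classic). Qed.

(* Zorn's lemma, applied to the subsets closed under [a *: x + y] that meet [S]
   in 0 only; the empty set is among them. *)
Lemma sset_complement : exists A : set V,
  [/\ forall a x y, A x -> A y -> A (a *: x + y),
      forall x, A x -> sset S x -> x = 0
    & forall v, exists s : subsp S, A (v - sinj s)].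
Proof.
have [S0 Slin] := subspace_closed S.
pose P (A : set V) := (forall a x y, A x -> A y -> A (a *: x + y)) /\
  (forall x, A x -> sset S x -> x = 0).
have [F FP Ftot|A [[Alin AS] Amax]] := @Zorn_bigcup V P.
  split=> [a x y [X FX Xx] [Y FY Yy] | x [X FX Xx] Sx]; last exact: (FP X FX).2.
  by have [XY|YX] := Ftot X Y FX FY; [exists Y | exists X] => //;
    apply: (FP _ _).1 => //; [apply: XY | apply: YX].
have A0 : A 0.
  have [[x Ax]|NA] := pselect (exists x, A x).
    by rewrite -(addNr x) -scaleN1r; apply: Alin.
  (* Were the maximal set empty, [{0}] would be a strictly larger admissible set. *)
  case: (Amax [set 0]%classic); last first.
    by split=> [a _ _ -> ->|x -> //]; rewrite scaler0 addr0.
  split=> [x Ax|A0]; first by case: NA; exists x.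
  by case: NA; exists 0; apply: A0.
have AN x : A x -> A (- x) by move=> Ax; rewrite -scaleN1r -[_ *: _]addr0; apply: Alin.
exists A; split=> // v; apply: contrapT => Nv.
have {}Nv s : sset S s -> ~ A (v - s).
  by move=> /sinj_surj[x <-] Avx; apply: Nv; exists x.
pose B : set V := [set z | exists a x, A x /\ z = a *: v + x]%classic.
apply: (Amax B); split.
- by move=> x Ax; exists 0, x; rewrite scale0r add0r.
- move=> BA; apply: (Nv 0) => //; rewrite subr0; apply: BA.
  by exists 1, 0; rewrite scale1r addr0.
- move=> a _ _ [b [x [Ax ->]]] [c [y [Ay ->]]].
  exists (a * b + c), (a *: x + y); split; first exact: Alin.
  by rewrite scalerDr scalerA scalerDl addrACA.
- move=> _ [a [x [Ax ->]]] Sz; have [a0|a0] := eqVneq a 0.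
    by move: Sz; rewrite a0 scale0r add0r; apply: AS.
  (* If [a *: v + x] lies in [S] with [a] nonzero, dividing by [a] writes [v] as an element of [S]
     plus one of [A], which [v] was chosen not to admit. *)
  case: (Nv (a^-1 *: (a *: v + x))).
    by rewrite -[_ *: _]addr0; apply: Slin.
  rewrite scalerDr scalerA mulVf // scale1r opprD addrA subrr add0r.
  by rewrite -scalerN -[_ *: _]addr0; apply: Alin => //; apply: AN.
Qed.

(** The [S]-component of [v] modulo the complement is unique, because two candidates differ by an
    element of both [A] and [S]; uniqueness makes the choice linear. *)
Lemma subsp_retraction :
  exists r : {linear V -> subsp S}, cancel (@sinj _ _ S) r.
Proof.
have [A [Alin AS Adec]] := sset_complement.
have [S0 Slin] := subspace_closed S.
pose r v : subsp S := xget 0 [set s | A (v - sinj s)]%classic.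
have rA v : A (v - sinj (r v)).
  by have [s As] := Adec v; apply: (@xgetI _ _ [set s | A (v - sinj s)]%classic s).
have rU v s : A (v - sinj s) -> r v = s.
  move=> As; apply: sinj_inj; apply/eqP; rewrite -subr_eq0; apply/eqP/AS; last first.
    by rewrite -linearB; exact: sinjP.
  have -> : sinj (r v) - sinj s = (-1) *: (v - sinj (r v)) + (v - sinj s).
    by rewrite scaleN1r opprB addrA subrK.
  exact: Alin.
have r_lin : linear r.
  move=> a x y; apply: rU; rewrite [sinj _]linearP opprD addrACA -scalerBr.
  by apply: Alin.
exists (HB.pack r (GRing.isLinear.Build k V (subsp S) *:%R r r_lin) : {linear _ -> _}) => //.
move=> s /=; apply: rU; rewrite subrr.
(* That [A] contains 0 is recovered from its closure property as [- x + x], for [x] the element of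
   [A] supplied by [rA 0]. *)
by have := Alin (-1) _ _ (rA 0) (rA 0); rewrite scaleN1r addNr.
Qed.

End Retraction.

(** * Equality of linear maps checked on pure tensors *)

Section LinearExtension.
Variable k : fieldType.
Implicit Types V W U : lmodType k.

Lemma lin_add V W (f g : V -> W) : linear f -> linear g -> linear (fun x => f x + g x).
Proof. by move=> fL gL a x y; rewrite fL gL scalerDr addrACA. Qed.

Lemma lin_opp V W (f : V -> W) : linear f -> linear (fun x => - f x).
Proof. by move=> fL a x y; rewrite fL opprD scalerN. Qed.

Lemma lin_scale V W (f : V -> W) c : linear f -> linear (fun x => c *: f x).
Proof. by move=> fL a x y; rewrite fL scalerDr !scalerA mulrC. Qed.

Lemma tens_extP V W U (f g : V \ox W -> U) : linear f -> linear g ->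
  (forall v w, f (v \ot w) = g (v \ot w)) -> forall t, f t = g t.
Proof.
move=> fL gL.
exact: (tens_ext (f := HB.pack f (GRing.isLinear.Build _ _ _ _ f fL))
                 (g := HB.pack g (GRing.isLinear.Build _ _ _ _ g gL))).
Qed.

End LinearExtension.

Ltac lin_tac :=
  first
  [ let a := fresh "a" in let x := fresh "x" in let y := fresh "y" in
    move=> a x y; cbv beta;
    first [by rewrite scaler0 addr0 | by rewrite ?(tens_linl, linearP)]
  | apply: lin_add; lin_tac
  | apply: lin_opp; lin_tac
  | apply: lin_scale; lin_tac ].

Tactic Notation "tens_ext" hyp(t) "as" ident(v) ident(w) :=
  move: t; apply: tens_extP; [lin_tac | lin_tac | move=> v w].

(* Canonical structure inference sees [idfun], not the [fun x => x] that [id]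
   stands for. *)
Ltac fold_idfun := repeat match goal with
  | |- context [@tmap ?k ?V ?V' ?W ?W' (fun x => x) ?f] =>
    change (@tmap k V V' W W' (fun x => x) f) with (@tmap k V V' W W' idfun f)
  | |- context [@tmap ?k ?V ?V' ?W ?W' ?f (fun x => x)] =>
    change (@tmap k V V' W W' f (fun x => x)) with (@tmap k V V' W W' f idfun)
  end.

Ltac tens_simp := do ?[progress rewrite ?(tmapE, tswapE, tassocE, tcycE) /=].

Section TensorIdentities.
Variable k : fieldType.
Implicit Types V W U : lmodType k.

Lemma tmapK V V' W W' (f : {linear V -> V'}) (f' : {linear V' -> V})
    (h : {linear W -> W'}) (h' : {linear W' -> W}) :
  cancel f f' -> cancel h h' -> cancel (tmap f h) (tmap f' h').
Proof. by move=> fK hK t; tens_ext t as v w; rewrite !tmapE fK hK. Qed.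

Lemma tswap_tmap V V' W W' (f : {linear V -> V'}) (h : {linear W -> W'}) t :
  tswap (tmap f h t) = tmap h f (tswap t).
Proof. by tens_ext t as v w; rewrite !(tmapE, tswapE). Qed.

Lemma tswapK V W : cancel (@tswap k V W) (@tswap k W V).
Proof. by move=> t; tens_ext t as v w; rewrite !tswapE. Qed.

Lemma tcyc_tmap V W (f : {linear V -> W}) t :
  tcyc (tmap (tmap f f) f t) = tmap (tmap f f) f (tcyc t).
Proof.
by tens_ext t as s c; tens_ext s as a b; tens_simp.
Qed.

End TensorIdentities.

(** * Transfer of the Lie bialgebra axioms along a split embedding *)

Section BialgebraEmbedding.
Variables (k : fieldType) (g g' : lmodType k).
Variables (br : g -> g -> g) (cobr : g -> g \ox g).
Variables (br' : g' -> g' -> g') (cobr' : g' -> g' \ox g').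
Hypothesis gB : is_lie_bialgebra br cobr.
Variables (i : {linear g' -> g}) (r : {linear g -> g'}).
Hypothesis iK : cancel i r.
Hypothesis i_br : forall x y, i (br' x y) = br (i x) (i y).
Hypothesis i_cobr : forall x, tmap i i (cobr' x) = cobr (i x).

Let i_inj : injective i := can_inj iK.
Let ii_inj : injective (tmap i i) := can_inj (tmapK iK iK).

Let cobr_lin : linear cobr := colie_lin (bialg_colie gB).
(** Packed and locally canonical, so that [linearP] and [tmapE] apply to the bare function [cobr];
    the similar definitions below have the same purpose. *)
Definition cobrL : {linear g -> g \ox g} :=
  HB.pack cobr (GRing.isLinear.Build k _ _ _ cobr cobr_lin).
#[local] Canonical cobrL.
Let br_lin x : linear (br x) := (lie_bilin (bialg_lie gB)).1 x.
Definition brL x : {linear g -> g} :=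
  HB.pack (br x) (GRing.isLinear.Build k _ _ _ (br x) (br_lin x)).
#[local] Canonical brL.

Lemma embed_lie : is_lie_bracket br'.
Proof.
have [[brr brl] alt jac] := bialg_lie gB; split.
- split=> v a x y; apply: i_inj.
    by rewrite /= linearP /= !i_br [i (_ + _)]linearP /= brr.
  by rewrite /= linearP /= !i_br [i (_ + _)]linearP /= brl.
- by move=> x; apply: i_inj; rewrite i_br alt linear0.
- by move=> x y z; apply: i_inj; rewrite !linearD !i_br jac linear0.
Qed.

Let cobr'_lin : linear cobr'.
Proof. by move=> a x y; apply: ii_inj; rewrite linearP /= !i_cobr [i _]linearP /= linearP. Qed.
Definition cobrL' : {linear g' -> g' \ox g'} :=
  HB.pack cobr' (GRing.isLinear.Build k _ _ _ cobr' cobr'_lin).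
#[local] Canonical cobrL'.
Let br_lin' x : linear (br' x) := (lie_bilin embed_lie).1 x.
Definition brL' x : {linear g' -> g'} :=
  HB.pack (br' x) (GRing.isLinear.Build k _ _ _ (br' x) (br_lin' x)).
#[local] Canonical brL'.

Lemma embed_tact x t : tmap i i (tact br' x t) = tact br (i x) (tmap i i t).
Proof.
rewrite /tact linearD; fold_idfun; tens_ext t as a b.
by tens_simp; rewrite !i_br.
Qed.

Lemma embed_cobr2 t : tmap (tmap i i) i (tmap cobr' id t) = tmap cobr id (tmap i i t).
Proof. by fold_idfun; tens_ext t as a b; tens_simp; rewrite i_cobr. Qed.

(** Only compatibility with [i] is assumed of [br'] and [cobr']; their linearity is deduced, since
    in the applications they may be choices made by [corestr]. *)
Lemma lie_bialgebra_embed : is_lie_bialgebra br' cobr'.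
Proof.
have [_ anti jac] := bialg_colie gB; split; first exact: embed_lie; first split=> //.
- move=> x; apply: ii_inj; rewrite linearD /= -tswap_tmap i_cobr anti.
  by rewrite linear0.
- move=> x t; have iii_inj : injective (tmap (tmap i i) i).
    exact: can_inj (tmapK (tmapK iK iK) iK).
  apply: iii_inj; rewrite !linearD /= -!tcyc_tmap embed_cobr2 i_cobr.
  by rewrite (jac (i x)) linear0.
- by move=> x y; apply: ii_inj; rewrite linearB /= !embed_tact !i_cobr i_br bialg_cocycle.
Qed.

End BialgebraEmbedding.

Arguments tact : simpl never.

(** * Linear families of maps and cyclic sums *)

Section LinearFamilies.
Variables (k : fieldType) (X V V' W W' : lmodType k).

Lemma tmap_linl (F : X -> {linear V -> V'}) (h : {linear W -> W'}) :
  (forall v, linear (fun x => F x v)) -> forall t, linear (fun x => tmap (F x) h t).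
Proof.
move=> FL; apply: tensor_ind => [|b s t IHs IHt|v w] a x y; cbv beta.
- by rewrite !linear0 addr0.
- by rewrite !linearP /= IHs IHt; lmod k.
- by rewrite !tmapE FL tensDl tensZl.
Qed.

Lemma tmap_linr (F : {linear V -> V'}) (h : X -> {linear W -> W'}) :
  (forall v, linear (fun x => h x v)) -> forall t, linear (fun x => tmap F (h x) t).
Proof.
move=> FL; apply: tensor_ind => [|b s t IHs IHt|v w] a x y; cbv beta.
- by rewrite !linear0 addr0.
- by rewrite !linearP /= IHs IHt; lmod k.
- by rewrite !tmapE FL tensDr tensZr.
Qed.

End LinearFamilies.

Section CyclicSum.
Variables (k : fieldType) (V : lmodType k).

Definition cyc_sum (t : (V \ox V) \ox V) := t + tcyc t + tcyc (tcyc t).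

Lemma cyc_sum_linear : linear cyc_sum.
Proof. by rewrite /cyc_sum; lin_tac. Qed.

HB.instance Definition _ :=
  GRing.isLinear.Build k ((V \ox V) \ox V) ((V \ox V) \ox V) *:%R cyc_sum cyc_sum_linear.

End CyclicSum.

Arguments cyc_sum : simpl never.

(** * The adjoint action on the tensor square *)

Section LieAlgebra.
Variables (k : fieldType) (g : lmodType k) (br : g -> g -> g).
Hypothesis gL : is_lie_bracket br.

Let brlin x : linear (br x) := (lie_bilin gL).1 x.
Definition lbrL x : {linear g -> g} :=
  HB.pack (br x) (GRing.isLinear.Build k _ _ _ (br x) (brlin x)).
#[local] Canonical lbrL.

Lemma brC x y : br x y = - br y x.
Proof.
have [[_ brl] alt _] := gL; apply/eqP; rewrite -addr_eq0; apply/eqP.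
have D u v w : br (u + v) w = br u w + br v w.
  by have := brl w 1 u v; rewrite !scale1r.
by have := alt (x + y); rewrite D !linearD /= !alt add0r addr0 => <-; rewrite addrC.
Qed.

Lemma br_linl y : linear (br^~ y).
Proof. exact: (lie_bilin gL).2. Qed.

Definition lbrR y : {linear g -> g} :=
  HB.pack (br^~ y) (GRing.isLinear.Build k _ _ _ (br^~ y) (br_linl y)).
#[local] Canonical lbrR.

Lemma br_bracket x y z : br (br x y) z = br x (br y z) - br y (br x z).
Proof.
have := lie_jacobi gL x y z; rewrite [br z (br x y)]brC [br z x]brC linearN /=.
by move/eqP; rewrite subr_eq0 => /eqP <-.
Qed.

Lemma tact_linear x : linear (tact br x).
Proof. by rewrite /tact; fold_idfun; apply: lin_add; lin_tac. Qed.

Lemma tactE x a b : tact br x (a \ot b) = br x a \ot b + a \ot br x b.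
Proof. by rewrite /tact; fold_idfun; tens_simp. Qed.

Lemma tactD x s t : tact br x (s + t) = tact br x s + tact br x t.
Proof. by have := tact_linear x 1 s t; rewrite !scale1r. Qed.

Lemma tact0 x : tact br x 0 = 0.
Proof. by apply: (addIr (tact br x 0)); rewrite -tactD !add0r. Qed.

Lemma tactZ x c t : tact br x (c *: t) = c *: tact br x t.
Proof. by have := tact_linear x c t 0; rewrite tact0 !addr0. Qed.

Lemma tactN x t : tact br x (- t) = - tact br x t.
Proof. by rewrite -scaleN1r tactZ scaleN1r. Qed.

Definition tactL x : {linear g \ox g -> g \ox g} :=
  HB.pack (tact br x) (GRing.isLinear.Build k _ _ _ (tact br x) (tact_linear x)).
#[local] Canonical tactL.

Lemma tact_wedge x a b : tact br x (wedge a b) = wedge (br x a) b + wedge a (br x b).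
Proof. by rewrite /wedge tactD tactN !tactE; lmod k. Qed.

Lemma tact_linl t : linear (fun x => tact br x t).
Proof.
move=> c x y; tens_ext t as a b; rewrite !tactE !br_linl tensDl tensDr tensZl tensZr.
by rewrite scalerDr addrACA.
Qed.

(** The module law of the tensor square: it makes the cocycle extension respect the Jacobi
    relation. *)
Lemma tact_bracket x y t :
  tact br (br x y) t = tact br x (tact br y t) - tact br y (tact br x t).
Proof.
tens_ext t as a b; rewrite !(tactE, tactD) !br_bracket.
rewrite tensDl tensNl tensDr tensNr; lmod k.
Qed.

(** * The cobracket of Serre elements *)

Section SerreCobracket.
(* [eps] is 1 for [y], [z] = f_i, f_j and -1 for e_i, e_j; [li] = d_i / 2 and
   [a] = C i j. *)
Variables (y z hi hj : g) (eps li lj a : k).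
Hypothesis br_yi : br y hi = (2%:R * eps) *: y.
Hypothesis br_yj : lj *: br y hj = (eps * li * a) *: y.
Hypothesis br_zi : br z hi = (eps * a) *: z.

Let x n := iter n (br y) z.

(** The cocycle recursion for the iterated bracket [x n], started from cobrackets [li *: wedge y hi]
    of [y] and [lj *: wedge z hj] of [z]. *)
Fixpoint serre_cobr n : g \ox g :=
  if n is m.+1 then tact br y (serre_cobr m) - tact br (x m) (li *: wedge y hi)
  else lj *: wedge z hj.

Lemma br_serre_h n : br (x n) hi = (eps * (2%:R * n%:R + a)) *: x n.
Proof.
elim: n => [|n IHn]; first by rewrite mulr0 add0r.
rewrite /x iterS -/(x n) br_bracket IHn br_yi !linearZ /= [br (x n) y]brC -natr1.
by lmod k.
Qed.

(** Passing from [n] to [n.+1] adds [2 * eps * li * (2 * n + a)] to the coefficient of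
    [wedge y (x n)]: half comes from [y] acting on [hi] and [hj], half from [[x n, hi]]. The sum of
    [2 * m + a] over [m <= n] is [(n + 1) * (n + a)]. *)
Lemma serre_cobrE n :
  serre_cobr n.+1 = wedge (x n.+1) ((n.+1%:R * li) *: hi + lj *: hj)
    - (2%:R * eps * li * n.+1%:R * (n%:R + a)) *: wedge y (x n).
Proof.
have tE := (tensDl, tensDr, tensZl, tensZr, tensNl, tensNr).
(* [T] stands for [wedge y] of the preceding [x], which [y] sends to [wedge y (x n')] since [[y, y]
   = 0]; for [n' = 0] there is no preceding [x], whence the alternative [c = 0]. *)
have step c (T : g \ox g) n' : serre_cobr n' =
    wedge (x n') ((n'%:R * li) *: hi + lj *: hj) - c *: T ->
    tact br y T = wedge y (x n') \/ c = 0 ->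
    serre_cobr n'.+1 = wedge (x n'.+1) ((n'.+1%:R * li) *: hi + lj *: hj)
      - (c + 2%:R * eps * li * (2%:R * n'%:R + a)) *: wedge y (x n').
  move=> /= -> HT.
  have cT : c *: tact br y T = c *: wedge y (x n').
    by case: HT => -> //; rewrite !scale0r.
  rewrite tactD tactN tactZ cT tactZ !tact_wedge -/(x n'.+1).
  rewrite br_serre_h [br (x n') y]brC linearD /= !linearZ /= br_yi br_yj.
  have -> : br y (x n') = x n'.+1 by [].
  by rewrite /wedge !tE -natr1; lmod k.
elim: n => [|n IHn].
  rewrite (step 0 0 0%N); [by congr (_ - _ *: _); ring | rewrite /= | by right].
  by rewrite /wedge !tE; lmod k.
rewrite (step _ _ _ IHn); last by left; rewrite tact_wedge (lie_alt gL) /wedge tens0l tens0r subrr add0r.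
by congr (_ - _ *: _); rewrite -!natr1; ring.
Qed.

End SerreCobracket.

(** * The Jacobiator of a cocycle *)

Section CoJacobi.
Variable cobr : g -> g \ox g.
Hypothesis cobr_lin : linear cobr.
Hypothesis cobr_anti : forall x, tswap (cobr x) = - cobr x.
Hypothesis cobr_cocycle : forall x y,
  cobr (br x y) = tact br x (cobr y) - tact br y (cobr x).

Definition cocycleL : {linear g -> g \ox g} :=
  HB.pack cobr (GRing.isLinear.Build k _ _ _ cobr cobr_lin).
#[local] Canonical cocycleL.

Definition tact3 (x : g) (t : (g \ox g) \ox g) : (g \ox g) \ox g :=
  tmap (tact br x) idfun t + tmap idfun (br x) t.

Arguments tact3 : simpl never.

Lemma tact3_linear x : linear (tact3 x).
Proof. by rewrite /tact3; lin_tac. Qed.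

Definition tact3L x : {linear (g \ox g) \ox g -> (g \ox g) \ox g} :=
  HB.pack (tact3 x) (GRing.isLinear.Build k _ _ _ (tact3 x) (tact3_linear x)).
#[local] Canonical tact3L.

Lemma cyc_sum_tact3 x t : cyc_sum (tact3 x t) = tact3 x (cyc_sum t).
Proof.
tens_ext t as s c; tens_ext s as a b.
rewrite /cyc_sum /tact3 !linearD /=; tens_simp.
by rewrite !tactE !tensDl !linearD /= !tcycE; lmod k.
Qed.

(** The two halves of [tact br a s], as functions of [a]. They appear when [cobr] meets a bracket
    inside a leg of a tensor, and the cyclic sum moves them to different places. *)
Definition lact (s : g \ox g) (a : g) : g \ox g := tmap (br a) idfun s.
Definition ract (s : g \ox g) (a : g) : g \ox g := tmap idfun (br a) s.

Lemma lact_linear s : linear (lact s).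
Proof. by apply: tmap_linl => v; apply: br_linl. Qed.
Lemma ract_linear s : linear (ract s).
Proof. by apply: tmap_linr => v; apply: br_linl. Qed.

Definition lactL s : {linear g -> g \ox g} :=
  HB.pack (lact s) (GRing.isLinear.Build k _ _ _ (lact s) (lact_linear s)).
#[local] Canonical lactL.
Definition ractL s : {linear g -> g \ox g} :=
  HB.pack (ract s) (GRing.isLinear.Build k _ _ _ (ract s) (ract_linear s)).
#[local] Canonical ractL.

Lemma lact_linl t e s s' : tmap (lact (e *: s + s')) (@idfun g) t =
  e *: tmap (lact s) (@idfun g) t + tmap (lact s') (@idfun g) t.
Proof.
apply: (tmap_linl (F := lactL)) => a c x y.
by rewrite -[LHS]/(tmap (br a) (@idfun g) (c *: x + y)) linearP.
Qed.
Lemma ract_linl t e s s' : tmap (ract (e *: s + s')) (@idfun g) t =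
  e *: tmap (ract s) (@idfun g) t + tmap (ract s') (@idfun g) t.
Proof.
apply: (tmap_linl (F := ractL)) => a c x y.
by rewrite -[LHS]/(tmap (@idfun g) (br a) (c *: x + y)) linearP.
Qed.

(* With [tswap s = - s] and [tswap t = - t] this says that the cross terms of
   the Jacobiator cancel (see [cobr2_tact]). *)
Lemma cyc_sum_cross s t :
  cyc_sum (tmap (lact s) (@idfun g) t) - cyc_sum (tmap (ract (tswap s)) (@idfun g) t)
  = cyc_sum (tmap (lact t) (@idfun g) s) - cyc_sum (tmap (ract (tswap t)) (@idfun g) s).
Proof.
move: t; apply: tens_extP => [e x y|e x y|c d]; cbv beta.
  by rewrite !linearP /=; lmod k.
  by rewrite lact_linl [tswap _]linearP /= ract_linl !linearP /=; lmod k.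
move: s; apply: tens_extP => [e x y|e x y|a b]; cbv beta.
  by rewrite lact_linl [tswap _]linearP /= ract_linl !linearP /=; lmod k.
  by rewrite !linearP /=; lmod k.
rewrite !tswapE !tmapE /= /lact /ract !tmapE /cyc_sum /= !tcycE.
by rewrite [br a c]brC !(tensNl, tensNr); lmod k.
Qed.

Lemma cobr2_tact x t : tmap cobr (@idfun g) (tact br x t) =
  tact3 x (tmap cobr (@idfun g) t)
  - (tmap (lact (cobr x)) (@idfun g) t + tmap (ract (cobr x)) (@idfun g) t).
Proof.
tens_ext t as a b; rewrite tactE /tact3 linearD /= !tmapE /= cobr_cocycle.
by rewrite {2}/tact !tensDl tensNl tensDl /lact /ract; fold_idfun; lmod k.
Qed.

(** By [cobr2_tact], applying [cobr] to the first leg commutes with the action of [x] up to cross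
    terms in [cobr x] and [cobr y]. Their cyclic sum is symmetric in [x] and [y] by [cyc_sum_cross],
    so it drops out of the difference. *)
Lemma cobr_jacobiator_cocycle x y :
  cyc_sum (tmap cobr (@idfun g) (cobr (br x y))) =
  tact3 x (cyc_sum (tmap cobr (@idfun g) (cobr y)))
  - tact3 y (cyc_sum (tmap cobr (@idfun g) (cobr x))).
Proof.
rewrite cobr_cocycle linearB /= !cobr2_tact !(linearB (@cyc_sum k g)) /= !(linearD (@cyc_sum k g)) /=.
rewrite -!cyc_sum_tact3 /tact3 !(linearD (@cyc_sum k g)) /=.
have := cyc_sum_cross (cobr x) (cobr y); rewrite !cobr_anti.
have N s t : tmap (ract (- s)) (@idfun g) t = - tmap (ract s) (@idfun g) t.
  have := ract_linl t (-1) s 0; rewrite addr0 scaleN1r => ->.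
  have := ract_linl t (-1) 0 0; rewrite addr0 scaler0 => /eqP.
  by rewrite scaleN1r addrC subrr => /eqP ->; rewrite scaleN1r addr0.
rewrite !N !linearN /= !opprK => /eqP E.
by apply/eqP; rewrite -subr_eq0; move: E; rewrite -subr_eq0 -oppr_eq0;
  congr (_ == _); lmod k.
Qed.

End CoJacobi.

End LieAlgebra.

(** * Reassociation and composites of induced maps *)

Section TensorReassociation.
Variables (k : fieldType) (V W U : lmodType k).

(** The inverse of [tassoc], assembled from [tassoc] and flips so that its linearity needs no new
    nested lift. *)
Definition tassocV (t : (V \ox W) \ox U) : V \ox (W \ox U) :=
  tswap (tassoc (tswap (tassoc (tswap t)))).

Lemma tassocV_linear : linear tassocV.
Proof. by rewrite /tassocV; lin_tac. Qed.
HB.instance Definition _ :=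
  GRing.isLinear.Build k ((V \ox W) \ox U) (V \ox (W \ox U)) *:%R tassocV tassocV_linear.

Lemma tassocVE v w u : tassocV ((v \ot w) \ot u) = v \ot (w \ot u).
Proof. by rewrite /tassocV; tens_simp. Qed.

Definition rtens (w : W) (v : V) : V \ox W := v \ot w.
HB.instance Definition _ (w : W) :=
  GRing.isLinear.Build k V (V \ox W) *:%R (rtens w) (tens_linl w).

End TensorReassociation.

Section TmapComp.
Variables (k : fieldType) (V V' V'' W W' W'' : lmodType k).
Variables (p : {linear V' -> V''}) (p' : {linear V -> V'}).
Variables (h : {linear W' -> W''}) (h' : {linear W -> W'}).

Lemma tmap_comp0r t : (forall w, h (h' w) = 0) -> tmap p h (tmap p' h' t) = 0.
Proof.
move=> h0; elim/tensor_ind: t => [|a s t Hs Ht|v w]; first by rewrite !linear0.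
  by rewrite !linearP /= Hs Ht scaler0 addr0.
by rewrite !tmapE h0 tens0r.
Qed.

Lemma tmap_comp0l t : (forall v, p (p' v) = 0) -> tmap p h (tmap p' h' t) = 0.
Proof.
move=> p0; elim/tensor_ind: t => [|a s t Hs Ht|v w]; first by rewrite !linear0.
  by rewrite !linearP /= Hs Ht scaler0 addr0.
by rewrite !tmapE p0 tens0l.
Qed.

End TmapComp.

(** * Split projections of Lie bialgebras *)

Section Bosonisation.
Variables (k : fieldType) (g f b : lmodType k).
Variables (br : g -> g -> g) (cobr : g -> g \ox g).
Hypothesis gB : is_lie_bialgebra br cobr.
Variables (j : {linear f -> g}) (i : {linear b -> g}).
Variables (P : {linear g -> f}) (Q : {linear g -> b}).
Hypotheses (jK : cancel j P) (iK : cancel i Q).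
Hypotheses (Pi : forall x, P (i x) = 0) (Qj : forall xi, Q (j xi) = 0).
Hypothesis PQ_dec : forall z, z = j (P z) + i (Q z).
Variables (brf : f -> f -> f) (cobrf : f -> f \ox f).
Variables (act : f -> b -> b) (coact : b -> f \ox b).
Variables (bbr : b -> b -> b) (bcobr : b -> b \ox b).
Hypothesis j_br : forall xi eta, j (brf xi eta) = br (j xi) (j eta).
Hypothesis i_act : forall xi x, i (act xi x) = br (j xi) (i x).
Hypothesis i_br : forall x y, i (bbr x y) = br (i x) (i y).
Hypothesis j_cobr : forall xi, tmap j j (cobrf xi) = cobr (j xi).
Hypothesis coactE : forall x, coact x = tmap P Q (cobr (i x)).
Hypothesis bcobrE : forall x, bcobr x = tmap Q Q (cobr (i x)).
Hypothesis PP_cobr : forall x, tmap P P (cobr (i x)) = 0.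

Let gL : is_lie_bracket br := bialg_lie gB.
Let i_inj : injective i := can_inj iK.

Lemma boson_base_bialgebra : is_lie_bialgebra brf cobrf.
Proof. exact: (lie_bialgebra_embed gB jK j_br j_cobr). Qed.

Lemma boson_fiber_lie : is_lie_bracket bbr.
Proof. exact: (embed_lie gB iK i_br). Qed.

Let brlin x : linear (br x) := (lie_bilin gL).1 x.
Definition gbrL x : {linear g -> g} :=
  HB.pack (br x) (GRing.isLinear.Build k _ _ _ (br x) (brlin x)).
#[local] Canonical gbrL.
Definition gtactL x : {linear g \ox g -> g \ox g} :=
  HB.pack (tact br x) (GRing.isLinear.Build k _ _ _ (tact br x) (tact_linear gL x)).
#[local] Canonical gtactL.
Let cobrlin : linear cobr := colie_lin (bialg_colie gB).
Definition gcobrL : {linear g -> g \ox g} :=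
  HB.pack cobr (GRing.isLinear.Build k _ _ _ cobr cobrlin).
#[local] Canonical gcobrL.
Let brflin x : linear (brf x) := (lie_bilin (bialg_lie boson_base_bialgebra)).1 x.
Definition fbrL x : {linear f -> f} :=
  HB.pack (brf x) (GRing.isLinear.Build k _ _ _ (brf x) (brflin x)).
#[local] Canonical fbrL.
Let cobrflin : linear cobrf := colie_lin (bialg_colie boson_base_bialgebra).
Definition fcobrL : {linear f -> f \ox f} :=
  HB.pack cobrf (GRing.isLinear.Build k _ _ _ cobrf cobrflin).
#[local] Canonical fcobrL.
Let bbrlin x : linear (bbr x) := (lie_bilin boson_fiber_lie).1 x.
Definition bbrL x : {linear b -> b} :=
  HB.pack (bbr x) (GRing.isLinear.Build k _ _ _ (bbr x) (bbrlin x)).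
#[local] Canonical bbrL.

Lemma boson_act_bilin : bilin act.
Proof.
split=> [xi a x y|x a xi eta]; apply: i_inj.
  by rewrite [i (_ + _)]linearP !i_act !linearP.
by rewrite /= [i (_ + _)]linearP !i_act linearP (br_linl gL).
Qed.

Definition actL xi : {linear b -> b} :=
  HB.pack (act xi) (GRing.isLinear.Build k _ _ _ (act xi) (boson_act_bilin.1 xi)).
#[local] Canonical actL.
Let ract x xi : b := act xi x.
Let ractlin x : linear (ract x) := boson_act_bilin.2 x.
Definition actR x : {linear f -> b} :=
  HB.pack (ract x) (GRing.isLinear.Build k _ _ _ (ract x) (ractlin x)).
#[local] Canonical actR.
Let rbbr x y : b := bbr y x.
Let rbbrlin x : linear (rbbr x) := (lie_bilin boson_fiber_lie).2 x.
Definition bbrR x : {linear b -> b} :=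
  HB.pack (rbbr x) (GRing.isLinear.Build k _ _ _ (rbbr x) (rbbrlin x)).
#[local] Canonical bbrR.

Lemma boson_coact_linear : linear coact.
Proof. by move=> a x y; rewrite !coactE !linearP. Qed.
Definition coactL : {linear b -> f \ox b} :=
  HB.pack coact (GRing.isLinear.Build k _ _ _ coact boson_coact_linear).
#[local] Canonical coactL.

Lemma boson_bcobr_linear : linear bcobr.
Proof. by move=> a x y; rewrite !bcobrE !linearP. Qed.
Definition bcobrL : {linear b -> b \ox b} :=
  HB.pack bcobr (GRing.isLinear.Build k _ _ _ bcobr boson_bcobr_linear).
#[local] Canonical bcobrL.

(** * Components of the bracket and the cobracket along the splitting *)

Lemma P_br_j xi z : P (br (j xi) z) = brf xi (P z).
Proof. by rewrite {1}(PQ_dec z) linearD /= -j_br -i_act linearD /= jK Pi addr0. Qed.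

Lemma Q_br_j xi z : Q (br (j xi) z) = act xi (Q z).
Proof. by rewrite {1}(PQ_dec z) linearD /= -j_br -i_act linearD /= Qj iK add0r. Qed.

(** By [i_br] and [i_act] the image of [i] is an ideal. *)
Lemma P_br_i x z : P (br (i x) z) = 0.
Proof.
rewrite (PQ_dec z) linearD /= (brC gL _ (j _)) -i_br -i_act linearD linearN /=.
by rewrite !Pi oppr0 addr0.
Qed.

Lemma Q_br_i x z : Q (br (i x) z) = bbr x (Q z) - act (P z) x.
Proof.
rewrite {1}(PQ_dec z) linearD /= (brC gL _ (j _)) -i_br -i_act linearD linearN /=.
by rewrite !iK addrC.
Qed.

Lemma tswap_cobr z : tswap (cobr z) = - cobr z.
Proof. by apply/eqP; rewrite -addr_eq0 addrC (colie_anti (bialg_colie gB)). Qed.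

(** Together with [P_br_j] and [P_br_i] this makes [P] a Lie bialgebra morphism split by [j]. *)
Lemma PP_cobrE z : tmap P P (cobr z) = cobrf (P z).
Proof.
rewrite {1}(PQ_dec z) linearD /= linearD /= PP_cobr addr0 -j_cobr.
exact: (tmapK jK jK).
Qed.

Lemma PQ_cobrE z : tmap P Q (cobr z) = coact (Q z).
Proof.
rewrite {1}(PQ_dec z) linearD /= linearD /= -coactE -j_cobr.
suff -> : tmap P Q (tmap j j (cobrf (P z))) = 0 by rewrite add0r.
exact: tmap_comp0r.
Qed.

Lemma QP_cobrE z : tmap Q P (cobr z) = - tswap (coact (Q z)).
Proof. by rewrite -PQ_cobrE tswap_tmap tswap_cobr linearN opprK. Qed.

Lemma QQ_cobrE z : tmap Q Q (cobr z) = bcobr (Q z).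
Proof.
rewrite {1}(PQ_dec z) linearD /= linearD /= -bcobrE -j_cobr.
suff -> : tmap Q Q (tmap j j (cobrf (P z))) = 0 by rewrite add0r.
exact: tmap_comp0r.
Qed.

(** Inserting [j P + i Q] in both legs gives four blocks; the block in the image of [j] twice
    vanishes by [PP_cobr]. *)
Lemma cobr_iE x : cobr (i x) =
  tmap i i (bcobr x) + tmap j i (coact x) - tmap i j (tswap (coact x)).
Proof.
have dec t : t = tmap j j (tmap P P t) + tmap j i (tmap P Q t) + tmap i j (tmap Q P t)
    + tmap i i (tmap Q Q t).
  tens_ext t as v w; rewrite !tmapE {1}(PQ_dec v) {1}(PQ_dec w).
  by rewrite !(tensDl, tensDr); lmod k.
rewrite (dec (cobr (i x))) PP_cobr PQ_cobrE QP_cobrE QQ_cobrE iK !linear0 linearN /=.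
by lmod k.
Qed.

Lemma cocycle z w : cobr (br z w) = tact br z (cobr w) - tact br w (cobr z).
Proof. exact: bialg_cocycle gB z w. Qed.

(** * The crossed module axioms *)

Lemma PQ_tact_j xi t : tmap P Q (tact br (j xi) t) =
  tmap (brf xi) idfun (tmap P Q t) + tmap idfun (act xi) (tmap P Q t).
Proof.
tens_ext t as u v.
by rewrite (tactE gL) linearD /= !tmapE /= P_br_j Q_br_j.
Qed.

(** [tmap P Q] is applied to the cocycle condition for [j xi] and [i v]. The last summand is [i v]
    acting on the second leg of [cobr (j xi)]; on the first leg it lands in the ideal, which [P]
    kills. *)
Lemma boson_coact_act xi v : coact (act xi v) =
  tmap (brf xi) idfun (coact v) + tmap idfun (act xi) (coact v)
  + tmap idfun (ract v) (cobrf xi).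
Proof.
rewrite coactE i_act cocycle linearB /= PQ_tact_j -coactE -j_cobr; congr (_ + _).
move: (cobrf xi) => t.
tens_ext t as x y.
rewrite !tmapE (tactE gL) linearD /= !tmapE P_br_i Q_br_i Qj jK tens0l add0r.
by rewrite linear0 add0r tensNr opprK jK.
Qed.

Let swap12 (t : (f \ox f) \ox b) := tmap (@tswap k f f) (@idfun b) t.

Lemma PPQ_cyc t c : tmap (tmap P P) Q (tcyc (t \ot c)) =
  swap12 (tassoc (P c \ot tswap (tmap Q P t))).
Proof.
rewrite /swap12; tens_ext t as x y; by rewrite tcycE !tmapE /= !tswapE tassocE !tmapE /= ?tswapE.
Qed.

Lemma PPQ_cyc2 t c : tmap (tmap P P) Q (tcyc (tcyc (t \ot c))) =
  tassoc (P c \ot tmap P Q t).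
Proof.
by tens_ext t as x y; rewrite !tcycE !tmapE /= ?tmapE tassocE .
Qed.

(** The image of co-Jacobi for [i v] under [P], [P], [Q] on the three legs. The two rotated summands
    are the iterated coaction in its two orders, with signs from [QP_cobrE]. *)
Lemma boson_coact_coaction v : tmap cobrf idfun (coact v) =
  tassoc (tmap idfun coact (coact v)) - swap12 (tassoc (tmap idfun coact (coact v))).
Proof.
have H1 t : tmap (tmap P P) Q (tmap cobr idfun t) = tmap cobrf idfun (tmap P Q t).
  by tens_ext t as x y; rewrite !tmapE /= PP_cobrE.
have H2 t : tmap (tmap P P) Q (tcyc (tmap cobr idfun t)) =
    - swap12 (tassoc (tmap idfun coact (tswap (tmap Q P t)))).
  rewrite /swap12; tens_ext t as x y.
  by rewrite !tmapE PPQ_cyc QP_cobrE linearN /= tswapK tensNr /swap12 !linearN /= tswapE tmapE.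
have H3 t : tmap (tmap P P) Q (tcyc (tcyc (tmap cobr idfun t))) =
    tassoc (tmap idfun coact (tswap (tmap Q P t))).
  by tens_ext t as x y; rewrite !tmapE PPQ_cyc2 PQ_cobrE tswapE tmapE.
have := congr1 (tmap (tmap P P) Q) (colie_jacobi (bialg_colie gB) (i v)).
cbv zeta; fold_idfun; rewrite !linearD /= H1 H2 H3 linear0 QP_cobrE iK !linearN /= tswapK.
rewrite /swap12 linearN /= -coactE => /eqP E.
apply/eqP; rewrite -subr_eq0; move: E; congr (_ == _); lmod k.
Qed.

Lemma boson_crossed_module : is_lie_crossed_module brf cobrf act coact.
Proof.
split.
- exact: boson_base_bialgebra.
- exact: boson_act_bilin.
- by move=> xi eta v; apply: i_inj; rewrite linearB /= !i_act j_br (br_bracket gL).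
- exact: boson_coact_linear.
- by move=> v t; exact: boson_coact_coaction.
- exact: boson_coact_act.
Qed.

(** * The braided-Lie bialgebra axioms *)

Lemma bcobr_jacobi x : cyc_sum (tmap bcobr idfun (bcobr x)) = 0.
Proof.
have H t : tmap (tmap Q Q) Q (tmap cobr idfun t) = tmap bcobr idfun (tmap Q Q t).
  by tens_ext t as u v; rewrite !tmapE /= QQ_cobrE.
have := congr1 (tmap (tmap Q Q) Q) (colie_jacobi (bialg_colie gB) (i x)).
by cbv zeta; fold_idfun; rewrite !linearD linear0 /= -!tcyc_tmap H -bcobrE.
Qed.

Lemma tswap_bcobr x : tswap (bcobr x) = - bcobr x.
Proof. by rewrite bcobrE tswap_tmap tswap_cobr linearN. Qed.

Lemma boson_fiber_colie : is_lie_cobracket bcobr.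
Proof.
split=> [|x|x t]; first exact: boson_bcobr_linear.
  by rewrite tswap_bcobr subrr.
exact: bcobr_jacobi.
Qed.

Lemma tcoact_bilin : bilin (fun v w : b =>
  tmap idfun (fun v2 => v2 \ot w) (coact v) + tmap idfun (fun w2 => v \ot w2) (coact w)).
Proof.
split=> [v|w]; apply: lin_add.
- by apply: (tmap_linr idfun (h := @rtens k b b)) => v' a x y; exact: linearP.
- by move=> a x y; rewrite !linearP.
- by move=> a x y; rewrite linearP; apply: (linearP (tmap idfun (rtens w))).
- by apply: (tmap_linr idfun (h := @tens k b b)) => w' a x y; exact: tens_linl.
Qed.

Lemma tcoactE v w : tcoact coact (v \ot w) =
  tmap idfun (fun v2 => v2 \ot w) (coact v) + tmap idfun (fun w2 => v \ot w2) (coact w).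
Proof. exact: tlift_tens tcoact_bilin. Qed.

Lemma tcoact_linear : linear (tcoact coact).
Proof. exact: tlift_linear tcoact_bilin. Qed.
Definition tcoactL : {linear b \ox b -> f \ox (b \ox b)} :=
  HB.pack (tcoact coact) (GRing.isLinear.Build k _ _ _ _ tcoact_linear).
#[local] Canonical tcoactL.

(** By [Q_br_i] the bracket with [i x] also sees the [P]-part of the second leg; that correction
    factors through [tmap P P t]. *)
Lemma PQ_tact_i x t : tmap P P t = 0 ->
  tmap P Q (tact br (i x) t) = tmap idfun (bbr x) (tmap P Q t).
Proof.
move=> PPt.
have -> : tmap P Q (tact br (i x) t) =
    tmap idfun (bbr x) (tmap P Q t) - tmap idfun (ract x) (tmap P P t).
  clear PPt; tens_ext t as u v.
  by rewrite (tactE gL) linearD /= !tmapE P_br_i Q_br_i tens0l add0r tensDr tensNr.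
by rewrite PPt linear0 subr0.
Qed.

Lemma boson_coact_br x y :
  coact (bbr x y) = tmap idfun (tlift bbr) (tcoact coact (x \ot y)).
Proof.
rewrite coactE i_br cocycle linearB /= !PQ_tact_i ?PP_cobr // -!coactE tcoactE.
have bbrB := lie_bilin boson_fiber_lie.
pose tb : {linear b \ox b -> b} :=
  HB.pack (tlift bbr) (GRing.isLinear.Build k _ _ _ _ (tlift_linear bbrB)).
change (tlift bbr) with (tb : _ -> _); rewrite linearD /= addrC; congr (_ + _).
  move: (coact x) => t.
  rewrite -[RHS]/(tmap idfun tb (tmap idfun (rtens y) t)).
  tens_ext t as u v; rewrite !tmapE /= tlift_tens //.
  by rewrite (brC boson_fiber_lie v) tensNr.
rewrite -[RHS]/(tmap idfun tb (tmap idfun (tens x) (coact y))).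
by move: (coact y) => t; tens_ext t as u v; rewrite !tmapE /= tlift_tens.
Qed.

(** The part of the cocycle condition with [cobr (j xi)] dies under [tmap Q Q]: [i x] acts on one
    leg at a time and leaves the other in the image of [j]. *)
Lemma boson_bcobr_act xi x : bcobr (act xi x) = tact act xi (bcobr x).
Proof.
rewrite bcobrE i_act cocycle linearB /= -j_cobr bcobrE.
rewrite -[RHS]/(tmap (act xi) idfun (tmap Q Q (cobr (i x)))
                + tmap idfun (act xi) (tmap Q Q (cobr (i x)))).
have -> : tmap Q Q (tact br (i x) (tmap j j (cobrf xi))) = 0.
  move: (cobrf xi) => t; elim/tensor_ind: t => [|a s t Hs Ht|u v].
  - by rewrite !linear0.
  - by rewrite !linearP /= Hs Ht; lmod k.
  - by rewrite tmapE (tactE gL) linearD /= !tmapE !Qj tens0l tens0r addr0.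
rewrite subr0; move: (cobr (i x)) => t; tens_ext t as u v.
by rewrite (tactE gL) linearD /= !tmapE /= !Q_br_j.
Qed.

Let P_QQ (t : (g \ox g) \ox g) : f \ox (b \ox b) := tmap P (tmap Q Q) (tassocV t).
Let P_QQlin : linear P_QQ. Proof. by rewrite /P_QQ; lin_tac. Qed.
Definition P_QQL : {linear (g \ox g) \ox g -> f \ox (b \ox b)} :=
  HB.pack P_QQ (GRing.isLinear.Build k _ _ _ P_QQ P_QQlin).
#[local] Canonical P_QQL.

(** The image of co-Jacobi under [P], [Q], [Q]. [H1] and [H2] give the coaction on either leg of
    [bcobr x], which [tcoact_split] reassembles; [H3] gives [coact] followed by [bcobr]. *)
Lemma boson_bcobr_coact x : tmap idfun bcobr (coact x) = tcoact coact (bcobr x).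
Proof.
have H1 t : P_QQ (tmap cobr idfun t) = tassocV (tmap coact idfun (tmap Q Q t)).
  tens_ext t as u v; rewrite !tmapE /= -PQ_cobrE; move: (cobr u) => s.
  by tens_ext s as a c; rewrite /P_QQ !tmapE !tassocVE !tmapE /= ?tmapE.
have H2 t : P_QQ (tcyc (tmap cobr idfun t)) =
    - tmap idfun (@tswap k b b) (tassocV (tmap coact idfun (tmap Q Q t))).
  tens_ext t as u v; rewrite !tmapE /= -[coact _]tswapK -[tswap (coact _)]opprK -QP_cobrE.
  move: (cobr u) => s.
  tens_ext s as a c; rewrite /P_QQ tcycE !tmapE /= [tswap (- _)]linearN /= tswapE tensNl.
  by rewrite !linearN /= opprK !tassocVE !tmapE /= tmapE tswapE.
have H3 t : P_QQ (tcyc (tcyc (tmap cobr idfun t))) =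
    tmap idfun bcobr (tswap (tmap Q P t)).
  tens_ext t as u v; rewrite !tmapE /= tswapE !tmapE /= -QQ_cobrE; move: (cobr u) => s.
  by tens_ext s as a c; rewrite /P_QQ !tcycE !tmapE /= !tassocVE !tmapE /= tmapE.
have tcoact_split s : tcoact coact s = tassocV (tmap coact idfun s)
    + tmap idfun (@tswap k b b) (tassocV (tmap coact idfun (tswap s))).
  tens_ext s as u v; rewrite tcoactE tswapE !tmapE /=; congr (_ + _).
    rewrite -[LHS]/(tmap idfun (rtens v) (coact u)); move: (coact u) => t.
    by tens_ext t as a c; rewrite tassocVE tmapE.
  rewrite -[LHS]/(tmap idfun (tens u) (coact v)); move: (coact v) => t.
  by tens_ext t as a c; rewrite tassocVE !tmapE /= tswapE.
have := congr1 P_QQ (colie_jacobi (bialg_colie gB) (i x)).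
cbv zeta; fold_idfun; rewrite !linearD /= H1 H2 H3 linear0 QP_cobrE iK -bcobrE.
rewrite linearN /= tswapK linearN /= tcoact_split tswap_bcobr !linearN /= => /eqP E.
by apply/eqP; rewrite eq_sym -subr_eq0; move: E; congr (_ == _); lmod k.
Qed.

Let half := half_braiding act coact.

Lemma half_braidingE v w : half v w = tmap (ract v) idfun (coact w).
Proof. by []. Qed.

Lemma half_braiding_bilin : bilin half.
Proof.
split=> [v a x y|w a v v']; first by rewrite !half_braidingE !linearP.
apply: (tmap_linl idfun (F := actR)) => xi c x y.
by rewrite -[LHS]/(act xi (c *: x + y)) linearP.
Qed.

Lemma inf_braidingE x y : inf_braiding act coact (x \ot y) =
  half x y - half y x - tswap (half x y) + tswap (half y x).
Proof.
have [hr hl] := half_braiding_bilin.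
apply: tlift_tens; split=> [v a w w'|w a v v'] /=; rewrite -/half.
  have E := hl v a w w'; rewrite /= in E; rewrite hr E !linearP /=; lmod k.
have E := hl w a v v'; rewrite /= in E; rewrite hr E !linearP /=; lmod k.
Qed.

(** The corrections come from legs in the image of [j], on which [i x] acts by minus the action on
    [x]. For [t] a cobracket they are, up to sign, a half-braiding and its flip. *)
Lemma QQ_tact_i x t : tmap Q Q (tact br (i x) t) =
  tact bbr x (tmap Q Q t) - tmap (ract x) idfun (tmap P Q t)
  - tmap idfun (ract x) (tmap Q P t).
Proof.
have tactb y : linear (tact bbr y) := tact_linear boson_fiber_lie y.
pose tb y : {linear b \ox b -> b \ox b} :=
  HB.pack (tact bbr y) (GRing.isLinear.Build k _ _ _ _ (tactb y)).
rewrite -[tact bbr x _]/(tb x _); tens_ext t as u v.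
rewrite (tactE gL) linearD /= !tmapE /= !Q_br_i (tactE boson_fiber_lie).
by rewrite !(tensDl, tensDr, tensNl, tensNr) /ract /=; lmod k.
Qed.

Lemma boson_bcobr_cocycle x y :
  bcobr (bbr x y) = tact bbr x (bcobr y) - tact bbr y (bcobr x)
                    - inf_braiding act coact (x \ot y).
Proof.
have S u v : tswap (half u v) = tmap idfun (ract u) (tswap (coact v)).
  by rewrite half_braidingE tswap_tmap.
rewrite bcobrE i_br cocycle linearB /= !QQ_tact_i !QQ_cobrE !PQ_cobrE !QP_cobrE !iK.
rewrite inf_braidingE !S !half_braidingE !linearN /=; lmod k.
Qed.

Lemma boson_braided : is_braided_lie_bialgebra brf cobrf act coact bbr bcobr.
Proof.
split.
- exact: boson_crossed_module.
- exact: boson_fiber_lie.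
- exact: boson_fiber_colie.
- by move=> xi x y; apply: i_inj; rewrite linearD /= i_act !i_br !i_act (br_bracket gL) subrK.
- exact: boson_coact_br.
- exact: boson_bcobr_act.
- exact: boson_bcobr_coact.
- exact: boson_bcobr_cocycle.
Qed.

(** * The isomorphism with the bosonisation *)

Let inb (x : b) : (b * f)%type := (x, 0).
Let inf (xi : f) : (b * f)%type := (0, xi).
Let inb_lin : linear inb. Proof. by move=> a x y; rewrite /inb; congr (_, _); rewrite /= ?scaler0 ?addr0. Qed.
Let inf_lin : linear inf. Proof. by move=> a x y; rewrite /inf; congr (_, _); rewrite /= ?scaler0 ?addr0. Qed.
Definition inbL : {linear b -> (b * f)%type} :=
  HB.pack inb (GRing.isLinear.Build k _ _ _ inb inb_lin).
#[local] Canonical inbL.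
Definition infL : {linear f -> (b * f)%type} :=
  HB.pack inf (GRing.isLinear.Build k _ _ _ inf inf_lin).
#[local] Canonical infL.

Let ij (p : (b * f)%type) : g := i p.1 + j p.2.
Let ij_lin : linear ij.
Proof. by move=> a x y; rewrite /ij /= !linearP; lmod k. Qed.
Definition ijL : {linear (b * f)%type -> g} :=
  HB.pack ij (GRing.isLinear.Build k _ _ _ ij ij_lin).
#[local] Canonical ijL.
Let QP (z : g) : (b * f)%type := (Q z, P z).
Let QP_lin : linear QP.
Proof. by move=> a x y; rewrite /QP !linearP. Qed.
Definition QPL : {linear g -> (b * f)%type} :=
  HB.pack QP (GRing.isLinear.Build k _ _ _ QP QP_lin).
#[local] Canonical QPL.

Let ijK : cancel ij QP.
Proof. by case=> x xi; rewrite /QP /ij /= !linearD /= iK Pi Qj jK addr0 add0r. Qed.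
Let QPK : cancel QP ij.
Proof. by move=> z; rewrite /ij /= addrC -PQ_dec. Qed.

Lemma ij_boson_br p q : ij (boson_br brf act bbr p q) = br (ij p) (ij q).
Proof.
case: p q => [x xi] [y eta]; rewrite /boson_br /ij /= linearB linearD /=.
have D u v w : br (u + v) w = br u w + br v w.
  by rewrite -[u]scale1r (br_linl gL) !scale1r.
by rewrite i_br !i_act j_br !D !linearD /= (brC gL (i x) (j eta)); lmod k.
Qed.

Lemma ij_boson_cobr p : tmap ij ij (boson_cobr cobrf coact bcobr p) = cobr (ij p).
Proof.
case: p => x xi; rewrite /boson_cobr /= -/inb -/inf.
have Ib t : tmap ij ij (tmap inb inb t) = tmap i i t.
  by tens_ext t as u v; rewrite !tmapE /= /ij /inb /inf /= !linear0 !addr0.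
have If t : tmap ij ij (tmap inf inf t) = tmap j j t.
  by tens_ext t as u v; rewrite !tmapE /= /ij /inb /inf /= !linear0 !add0r.
have Ifb t : tmap ij ij (tmap inf inb t) = tmap j i t.
  by tens_ext t as u v; rewrite !tmapE /= /ij /inb /inf /= !linear0 addr0 add0r.
have Ibf t : tmap ij ij (tmap inb inf t) = tmap i j t.
  by tens_ext t as u v; rewrite !tmapE /= /ij /inb /inf /= !linear0 addr0 add0r.
rewrite !(linearD (tmap ij ij)) (linearN (tmap ij ij)) /= Ib If Ifb Ibf.
by rewrite j_cobr linearD /= cobr_iE.
Qed.

Lemma boson_bialgebra :
  is_lie_bialgebra (boson_br brf act bbr) (boson_cobr cobrf coact bcobr).
Proof. exact: (lie_bialgebra_embed gB ijK ij_boson_br ij_boson_cobr). Qed.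

Lemma boson_isomorphic : lie_bialgebra_isomorphic br cobr
  (boson_br brf act bbr) (boson_cobr cobrf coact bcobr).
Proof.
split=> //; first exact: boson_bialgebra.
exists QP; split.
- exact: QP_lin.
- by exists ij.
- by move=> x y; apply: (can_inj ijK); rewrite ij_boson_br !QPK.
- by move=> x; rewrite -{1}(QPK x) -ij_boson_cobr; apply: (tmapK ijK ijK).
Qed.

End Bosonisation.

(** * The Kac-Moody bialgebra *)

Section KacMoodyCobracket.
Variables (k : fieldType) (I : finType) (D : root_datum k I) (d : I -> k).
Local Notation L := (km_algebra D).

Lemma km_clsD (s t : km_term D) : km_cls (KAdd s t) = km_cls s + km_cls t.
Proof. by rewrite -[RHS]/(km_add _ _) km_cls_add. Qed.

Lemma km_clsZ a (s : km_term D) : km_cls (KScale a s) = a *: km_cls s.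
Proof. by rewrite -[RHS]/(km_scale _ _) km_cls_scale. Qed.

Lemma km_ind (P : L -> Prop) :
  (forall x, P (km_H x)) -> (forall i, P (km_e D i)) -> (forall i, P (km_f D i)) ->
  P 0 -> (forall x y, P x -> P y -> P (x + y)) -> (forall a x, P x -> P (a *: x)) ->
  (forall x y, P x -> P y -> P (km_br x y)) -> forall x, P x.
Proof.
move=> PH PE PF P0 PD PZ PB x; rewrite -(km_repr x); elim: (repr x) => //.
- by move=> s Ps t Pt; rewrite km_clsD; apply: PD.
- by move=> a s Ps; rewrite km_clsZ; apply: PZ.
- by move=> s Ps t Pt; rewrite -km_cls_br; apply: PB.
Qed.

HB.instance Definition _ (x : L) :=
  GRing.isLinear.Build k L L *:%R (km_br x) ((lie_bilin (km_is_lie D)).1 x).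
HB.instance Definition _ (x : L) :=
  GRing.isLinear.Build k (L \ox L) (L \ox L) *:%R (tact (@km_br k I D) x)
    (tact_linear (km_is_lie D) x).

Lemma km_br_He x i : km_br (km_H x) (km_e D i) = (rd_alpha D i x : k) *: km_e D i.
Proof. by rewrite /km_H /km_e km_cls_br -km_clsZ; apply/km_clsP/km_HE. Qed.

Lemma km_br_Hf x i : km_br (km_H x) (km_f D i) = (- (rd_alpha D i x : k)) *: km_f D i.
Proof. by rewrite /km_H /km_f km_cls_br -km_clsZ; apply/km_clsP/km_HF. Qed.

Hypothesis dS : is_symmetrizer (cartan D) d.

(** [K] is [KE] with [eps = -1] or [KF] with [eps = 1]. The last hypothesis kills the first wedge of
    [serre_cobrE]: the cobracket of a word takes values in tensors over the quotient, where the
    Serre element is already 0. *)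
Lemma km_cobr_serre eps (K : I -> km_term D) i j :
  (forall l, km_cobr_term d (K l) =
    (d l / 2%:R) *: wedge (km_cls (K l)) (km_H (rd_h D l))) ->
  (forall l x, km_br (km_cls (K l)) (km_H x) = (eps * (rd_alpha D l x : k)) *: km_cls (K l)) ->
  i != j ->
  km_cls (iter `|(1 - cartan D i j)%R|%N (KBr (K i)) (K j)) = 0 ->
  km_cobr_term d (iter `|(1 - cartan D i j)%R|%N (KBr (K i)) (K j)) = 0.
Proof.
move=> dK brK ne.
have [m Cm] : exists m : nat, cartan D i j = - m%:Z.
  by exists `|cartan D i j|%N; have := gcm_off (rd_gcm D) ne; lia.
have -> : `|(1 - cartan D i j)%R|%N = m.+1 by rewrite Cm; lia.
have clsE n : km_cls (iter n (KBr (K i)) (K j)) = iter n (km_br (km_cls (K i))) (km_cls (K j)).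
  by elim: n => //= n <-; rewrite km_cls_br.
have cobrE n : km_cobr_term d (iter n (KBr (K i)) (K j)) =
    serre_cobr (@km_br k I D) (km_cls (K i)) (km_cls (K j)) (km_H (rd_h D i))
      (km_H (rd_h D j)) (d i / 2%:R) (d j / 2%:R) n.
  by elim: n => [|n IHn] /=; rewrite ?dK // IHn clsE.
rewrite clsE cobrE => x0.
rewrite (serre_cobrE (km_is_lie D) (eps := eps) (a := (cartan D i j)%:~R)).
- rewrite x0 Cm mulrNz subrr mulr0 scale0r subr0.
  by rewrite /wedge tens0l tens0r subrr.
- by rewrite brK rd_pairing (gcm_diag (rd_gcm D)) mulrC.
- rewrite brK rd_pairing scalerA; congr (_ *: _).
  (* [br_yj] involves [alpha_i(h_j) = C j i]; the symmetrizer turns [d j * C j i] into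
     [d i * C i j]. *)
  transitivity (eps / 2%:R * (d j * (cartan D j i)%:~R)); first by ring.
  by rewrite -(dS.2 i j); ring.
- by rewrite brK rd_pairing.
Qed.

Lemma km_cobr_term_eq (s t : km_term D) : km_eq s t -> km_cobr_term d s = km_cobr_term d t.
Proof.
have gL := km_is_lie D.
have tE := (tensDl, tensDr, tensZl, tensZr, tensNl, tensNr).
have tactl u v a x : tact (@km_br k I D) (a *: u + v) x =
    a *: tact (@km_br k I D) u x + tact (@km_br k I D) v x.
  by apply: (tact_linl gL).
have tactDl u v x :
    tact (@km_br k I D) (u + v) x = tact (@km_br k I D) u x + tact (@km_br k I D) v x.
  by have := tactl u v 1 x; rewrite !scale1r.
have tact0l x : tact (@km_br k I D) 0 x = 0.
  by have /eqP := tactDl 0 0 x; rewrite addr0 addrC -subr_eq subrr => /eqP.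
have tactZl u a x : tact (@km_br k I D) (a *: u) x = a *: tact (@km_br k I D) u x.
  by have := tactl u 0 a x; rewrite !addr0 tact0l addr0.
have tD := (tactDl, tactZl, tact0l, tactD gL, tactZ gL, tact0 gL, tactN gL).
elim=> {s t} /=.
- by [].
- by [].
- by move=> s t u _ -> _ ->.
- by move=> s s' t t' _ -> _ ->.
- by move=> a s s' _ ->.
- by move=> s s' t t' /km_clsP -> -> /km_clsP -> ->.
- by move=> s t u; lmod k.
- by move=> s t; lmod k.
- by move=> s; lmod k.
- by move=> a b s; lmod k.
- by move=> s; lmod k.
- by move=> s; lmod k.
- by move=> a s t; lmod k.
- by move=> a b s; lmod k.
- by move=> s s' t; rewrite km_clsD !tD; lmod k.
- by move=> s t t'; rewrite km_clsD !tD; lmod k.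
- by move=> a s t; rewrite km_clsZ !tD; lmod k.
- by move=> a s t; rewrite km_clsZ !tD; lmod k.
- by move=> s; rewrite subrr.
- by move=> s t u; rewrite -!km_cls_br !(tact_bracket gL) !tD; lmod k.
- by move=> a x y; rewrite scaler0 addr0.
- by move=> x y; rewrite !tD subrr.
- move=> i; rewrite /wedge !tD !(tactE gL) -/(km_f D i) -/(km_e D i).
  rewrite [km_br (km_f D i) (km_e D i)](brC gL).
  have -> : km_br (km_e D i) (km_f D i) = km_H (rd_h D i).
    by rewrite /km_e /km_f km_cls_br; apply/km_clsP/km_EF_diag.
  rewrite [km_br (km_f D i) _](brC gL) [km_br (km_e D i) (km_H _)](brC gL) km_br_He km_br_Hf.
  by rewrite !tE rd_pairing; lmod k.
- move=> i j ne; rewrite /wedge !tD !(tactE gL) -/(km_f D j) -/(km_e D i).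
  rewrite [km_br (km_f D j) (km_e D i)](brC gL).
  have -> : km_br (km_e D i) (km_f D j) = 0.
    by rewrite /km_e /km_f km_cls_br; apply/km_clsP/km_EF_off.
  rewrite [km_br (km_f D j) _](brC gL) [km_br (km_e D i) (km_H _)](brC gL) km_br_He km_br_Hf.
  rewrite oppr0 !tE !tens0l !tens0r !rd_pairing.
  (* Both terms of the cocycle formula for [[e_i, f_j]] are multiples of the wedge of [e_i] and
     [f_j]; symmetry of the scaled Cartan matrix makes them cancel. *)
  have E : d j / 2%:R * (cartan D j i)%:~R = d i / 2%:R * (cartan D i j)%:~R.
    by rewrite mulrAC -(dS.2 i j) mulrAC.
  transitivity ((d j / 2%:R * (cartan D j i)%:~R - d i / 2%:R * (cartan D i j)%:~R) *:
    (km_e D i \ot km_f D j - km_f D j \ot km_e D i)); first by lmod k.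
  by rewrite E subrr scale0r.
- move=> x i; rewrite /wedge !tD !(tactE gL) -/(km_e D i).
  have -> : km_br (km_H x) (km_H (rd_h D i)) = 0.
    by rewrite /km_H km_cls_br; apply/km_clsP/km_HH.
  by rewrite km_br_He !tE !tens0l !tens0r; lmod k.
- move=> x i; rewrite /wedge !tD !(tactE gL) -/(km_f D i).
  have -> : km_br (km_H x) (km_H (rd_h D i)) = 0.
    by rewrite /km_H km_cls_br; apply/km_clsP/km_HH.
  by rewrite km_br_Hf !tE !tens0l !tens0r; lmod k.
- move=> i j ne; apply: (@km_cobr_serre (-1) (@KE k I D)) => //.
    move=> l x; rewrite -/(km_e D l) (brC gL) km_br_He; lmod k.
  by apply/km_clsP/km_serreE.
- move=> i j ne; apply: (@km_cobr_serre 1 (@KF k I D)) => //.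
    move=> l x; rewrite -/(km_f D l) (brC gL) km_br_Hf; lmod k.
  by apply/km_clsP/km_serreF.
Qed.

Lemma km_cobrE (t : km_term D) : km_cobr d (km_cls t) = km_cobr_term d t.
Proof. exact/km_cobr_term_eq/km_repr_eq. Qed.

Lemma km_cobr_H x : km_cobr d (km_H x : L) = 0.
Proof. exact: km_cobrE. Qed.
Lemma km_cobr_e i : km_cobr d (km_e D i) = (d i / 2%:R) *: wedge (km_e D i) (km_H (rd_h D i)).
Proof. exact: km_cobrE. Qed.
Lemma km_cobr_f i : km_cobr d (km_f D i) = (d i / 2%:R) *: wedge (km_f D i) (km_H (rd_h D i)).
Proof. exact: km_cobrE. Qed.

Lemma km_cobr_linear : linear (km_cobr d : L -> L \ox L).
Proof.
move=> a x y; rewrite -(km_repr x) -(km_repr y) -km_clsZ -km_clsD !km_cobrE.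
by [].
Qed.
HB.instance Definition _ := GRing.isLinear.Build k L (L \ox L) *:%R (@km_cobr k I D d) km_cobr_linear.

Lemma km_cobr_br x y : km_cobr d (km_br x y : L) =
  tact (@km_br k I D) x (km_cobr d y) - tact (@km_br k I D) y (km_cobr d x).
Proof. by rewrite -(km_repr x) -(km_repr y) km_cls_br !km_cobrE. Qed.

Lemma tswap_wedge (x y : L) : tswap (wedge x y) = - wedge x y.
Proof. by rewrite /wedge linearB /= !tswapE; lmod k. Qed.

Lemma tswap_tact (x : L) t : tswap (tact (@km_br k I D) x t) = tact (@km_br k I D) x (tswap t).
Proof.
have gL := km_is_lie D.
tens_ext t as a b; rewrite (tactE gL) !linearD /= !tswapE (tactE gL); lmod k.
Qed.

Lemma km_cobr_anti (x : L) : tswap (km_cobr d x) = - km_cobr d x.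
Proof.
have gL := km_is_lie D.
elim/km_ind: x => [x|i|i||x y Hx Hy|a x Hx|x y Hx Hy].
- by rewrite km_cobr_H linear0 oppr0.
- by rewrite km_cobr_e linearZ /= tswap_wedge; lmod k.
- by rewrite km_cobr_f linearZ /= tswap_wedge; lmod k.
- by rewrite !linear0.
- by rewrite !linearD /= Hx Hy; lmod k.
- by rewrite !linearZ /= Hx; lmod k.
- by rewrite km_cobr_br linearB /= !tswap_tact Hx Hy !(tactN gL); lmod k.
Qed.

Lemma km_is_lie_bialgebra : is_lie_bialgebra (@km_br k I D) (@km_cobr k I D d).
Proof.
have gL := km_is_lie D.
split=> //; last exact: km_cobr_br.
split=> [|x|x t]; first exact: km_cobr_linear.
  by rewrite km_cobr_anti subrr.
change (cyc_sum (tmap (km_cobr d) (@idfun L) (km_cobr d x)) = 0).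
clear t.
(* Here the iterated cobracket is [c ^ 2] times [wedge y h \ot h], whose cyclic sum cancels in pairs
   because [h] occurs twice. *)
have wedge0 (c : k) (y h : L) : km_cobr d y = c *: wedge y h -> km_cobr d h = 0 ->
    cyc_sum (tmap (km_cobr d) idfun (km_cobr d y)) = 0.
  move=> dy dh; rewrite dy /wedge linearZ /= linearB /= !tmapE /= dy dh tens0l.
  rewrite /wedge subr0 tensZl tensDl tensNl /cyc_sum !linearZ /= !linearB /= !tcycE; lmod k.
elim/km_ind: x => [x|i|i||x y Hx Hy|a x Hx|x y Hx Hy].
- by rewrite km_cobr_H linear0 (linear0 (@cyc_sum k L)).
- by apply: wedge0 (km_cobr_e i) (km_cobr_H _).
- by apply: wedge0 (km_cobr_f i) (km_cobr_H _).
- by rewrite !linear0.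
- by rewrite !linearD /= Hx Hy add0r.
- by rewrite !linearZ /= Hx scaler0.
- rewrite (cobr_jacobiator_cocycle gL km_cobr_linear km_cobr_anti km_cobr_br) Hx Hy.
  by rewrite /tact3 !linear0 !addr0 subrr.
Qed.

End KacMoodyCobracket.

(** * Independence of eigenvectors and prescribed values of free functionals *)

Section Eigenvectors.
Variables (k : fieldType) (V : lmodType k).
Hypothesis char0 : [pchar k] =i pred0.

(** [T - N] kills the last of [N + 1] terms and multiplies the others by [n - N], which is nonzero
    in characteristic 0; the induction hypothesis applies to the rescaled vectors. *)
Lemma eigen_direct (T : {linear V -> V}) (v : nat -> V) N :
  (forall n, T (v n) = n%:R *: v n) -> \sum_(n < N) v n = 0 ->
  forall n, (n < N)%N -> v n = 0.
Proof.
elim: N v => // N IHN v Tv sum0.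
have vlt n : (n < N)%N -> v n = 0.
  move=> lt_nN; have ne0 : (n%:R - N%:R : k) != 0.
    rewrite -opprB -natrB ?(ltnW lt_nN) // oppr_eq0.
    by have /pcharf0P -> := char0; rewrite subn_eq0 -ltnNge.
  apply: (scalerI ne0); rewrite scaler0.
  apply: (IHN (fun n => (n%:R - N%:R) *: v n)) lt_nN => [m|].
    by rewrite linearZ /= Tv; lmod k.
  have := congr1 T sum0; rewrite linear0 linear_sum big_ord_recr /= Tv => sum1.
  move: sum0; rewrite big_ord_recr /= => /eqP; rewrite addr_eq0 => /eqP sum0.
  move: sum1 => /eqP; rewrite addr_eq0 => /eqP sum1.
  rewrite (eq_bigr (fun m : 'I_N => T (v m) - N%:R *: v m)) => [|m _]; last first.
    by rewrite Tv scalerBl.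
  by rewrite sumrB -scaler_sumr sum0 sum1 scalerN subrr.
move=> n; rewrite ltnS leq_eqVlt => /orP[/eqP ->|]; last exact: vlt.
rewrite big_ord_recr /= big1 ?add0r in sum0 => // m _; exact: vlt.
Qed.

End Eigenvectors.

Section DualBasis.
Variables (k : fieldType) (I : finType) (H : vectType k) (alpha : I -> 'Hom(H, k^o)).

(** A left kernel vector of the matrix of values on a basis is a linear relation between the
    functionals. Freeness thus gives full row rank, and a right inverse solves for [h]. *)
Lemma free_hom_eval (c : I -> k) :
  free [seq alpha i | i <- enum I] -> exists h : H, forall i, alpha i h = c i.
Proof.
move=> alpha_free.
pose e := vbasis {: H}.
pose A : 'M[k]_(#|I|, \dim {: H}) := \matrix_(i, j) (alpha (enum_val i) e`_j : k).
have A_free : row_free A.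
  rewrite -kermx_eq0; apply/eqP/row_matrixP => r; rewrite row0.
  set u := row r (kermx A).
  have uA : u *m A = 0 by apply/sub_kermxP; exact: row_sub.
  pose X := map_tuple alpha (enum_tuple I).
  have XE (l : 'I_#|I|) : X`_l = alpha (enum_val l).
    by rewrite (nth_map (enum_val l)) -?enum_val_nth // -cardE.
  have u0 : forall l, u 0 l = 0.
    have Xfree : free X by [].
    apply: (elimT freeP Xfree (fun l => u 0 l)).
    apply/lfunP => x; rewrite zero_lfunE sum_lfunE.
    rewrite (coord_vbasis (memvf x)) -/e.
    under eq_bigr => l _ do rewrite XE scale_lfunE linear_sum scaler_sumr.
    rewrite exchange_big big1 //= => m _.
    have uAm : \sum_l u 0 l * A l m = 0.
      by have := congr1 (fun B : 'rV_ _ => B 0 m) uA; rewrite mxE [RHS]mxE.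
    transitivity (coord e m x *: (\sum_l u 0 l * A l m : k^o)); last first.
      by rewrite [X in _ *: X]uAm scaler0.
    rewrite scaler_sumr; apply: eq_bigr => l _; rewrite [A l m]mxE linearZ /=.
    exact: mulrCA.
  by apply/rowP => l; rewrite u0 mxE.
pose w := pinvmx A *m (\col_i c (enum_val i)).
exists (\sum_(j < \dim {: H}) w j 0 *: e`_j) => i.
rewrite linear_sum /=.
transitivity ((A *m w) (enum_rank i) 0).
  rewrite mxE; apply: eq_bigr => j _; rewrite linearZ /= [A _ _]mxE enum_rankK.
  exact: mulrC.
by rewrite mulmxA mulmxVp // mul1mx mxE enum_rankK.
Qed.

End DualBasis.

(** * The negative Borel subalgebra and its grading *)

Section Borel.
Variables (k : fieldType) (I : finType) (D : root_datum k I) (d : I -> k).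
Variable deg : I -> nat.
Hypothesis char0 : [pchar k] =i pred0.
Hypothesis dS : is_symmetrizer (cartan D) d.
Local Notation L := (km_algebra D).
Local Notation B := (subsp (borel D)).
Local Notation G := (borel_graded D deg).
Local Notation sB := (@sinj k L (borel D)).
Local Notation sG n := (@sinj k B (G n)).
Local Notation homog := (in_borel_deg deg).

Lemma homog_borel n x : homog n x -> in_borel (x : L).
Proof.
elim=> {n x} [x|i|n|n a x y _ Bx _ By|m n x y _ Bx _ By].
- exact: borel_H.
- exact: borel_f.
- exact: borel_0.
- exact: borel_lin.
- exact: borel_br.
Qed.

Lemma homog_lift n x : homog n x -> exists s : subsp (G n), sB (sG n s) = x.
Proof.
move=> hx; have [y Ey] := @sinj_surj k L (borel D) x (homog_borel hx).
have [|s Es] := @sinj_surj k B (G n) y; first by rewrite /= /borel_graded_set /= Ey.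
by exists s; rewrite Es.
Qed.

Lemma homog_sinj n (s : subsp (G n)) : homog n (sB (sG n s)).
Proof. exact: (sinjP s). Qed.

Lemma borel_bracketE x y : sB (borel_bracket D x y) = km_br (sB x) (sB y).
Proof.
apply: corestrK; apply: (@sinj_surj k L (borel D)).
exact: borel_br (sinjP x) (sinjP y).
Qed.

(* The image in [L \ox L] of the degree [n] part of [B \ox B]. *)
Definition homog2 n (T : L \ox L) : Prop :=
  exists t : forall i : 'I_n.+1, subsp (G i) \ox subsp (G (n - i)%N),
    T = tmap sB sB (\sum_(i < n.+1) tmap (sG i) (sG (n - i)) (t i)).

Lemma homog2_lin n a T T' : homog2 n T -> homog2 n T' -> homog2 n (a *: T + T').
Proof.
move=> [t ->] [t' ->]; exists (fun i => a *: t i + t' i).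
rewrite -linearP /= scaler_sumr -big_split /=; congr (tmap _ _ _).
by apply: eq_bigr => i _; rewrite linearP.
Qed.

Lemma homog2_0 n : homog2 n 0.
Proof. by exists (fun=> 0); rewrite big1 ?linear0 // => i _; rewrite linear0. Qed.

Lemma homog2_tens p q x y : homog p x -> homog q y -> homog2 (p + q) (x \ot y).
Proof.
move=> /homog_lift[u <-] /homog_lift[v <-].
have lt_p : (p < (p + q).+1)%N by rewrite ltnS leq_addr.
(* The component must have type [subsp (G i) \ox subsp (G (p + q - i))], with degrees equal to [p]
   and [q] only propositionally; [corestr] transports [u] and [v]. *)
exists (fun i => if (i : nat) == p then corestr (sG i) (sG p u) \ot
                   corestr (sG (p + q - i)) (sG q v) else 0).
rewrite (bigD1 (Ordinal lt_p)) //= eqxx big1 => [|i ne]; last first.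
  by rewrite -(inj_eq val_inj) /= in ne; rewrite (negPf ne) linear0.
rewrite addr0 !tmapE /=; congr (sB _ \ot sB _); apply/esym/corestrK.
  by exists u.
by rewrite addKn; exists v.
Qed.

Lemma homog2_ind n (R : L \ox L -> Prop) : R 0 ->
  (forall a s t, R s -> R t -> R (a *: s + t)) ->
  (forall p q x y, (p + q)%N = n -> homog p x -> homog q y -> R (x \ot y)) ->
  forall T, homog2 n T -> R T.
Proof.
move=> R0 Rlin Rt T [t ->]; rewrite linear_sum; elim/big_ind: _ => // [x y Rx Ry|i _].
  by rewrite -[x]scale1r; apply: Rlin.
elim/tensor_ind: (t i) => [|a u v Ru Rv|u v]; first by rewrite !linear0.
  by rewrite !linearP; apply: Rlin.
rewrite tmapE /= tmapE /=; apply: (Rt i (n - i)%N _ _ _ (homog_sinj u) (homog_sinj v)).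
by rewrite subnKC // -ltnS.
Qed.

Lemma homog2_tact m n x T : homog m x -> homog2 n T ->
  homog2 (m + n) (tact (@km_br k I D) x T).
Proof.
move=> hx; elim/homog2_ind=> [|a s t Rs Rt|p q y z <- hy hz].
- by rewrite linear0; apply: homog2_0.
- by rewrite linearP; apply: homog2_lin.
rewrite (tactE (km_is_lie D)) -[_ \ot z]scale1r; apply: homog2_lin.
  by rewrite addnA; apply: homog2_tens => //; apply: borel_deg_br.
by rewrite addnCA; apply: homog2_tens => //; apply: borel_deg_br.
Qed.

Lemma km_cobrD x y : km_cobr d (x + y : L) = km_cobr d x + km_cobr d y.
Proof. by have := km_cobr_linear dS 1 x y; rewrite !scale1r. Qed.

Lemma km_cobr0 : km_cobr d (0 : L) = 0.
Proof. by apply: (addIr (km_cobr d (0 : L))); rewrite -km_cobrD !add0r. Qed.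

Lemma km_brDl (x y z : L) : km_br (x + y) z = km_br x z + km_br y z.
Proof. by rewrite -[x]scale1r (br_linl (km_is_lie D)) !scale1r. Qed.

Lemma km_br0l (z : L) : km_br 0 z = 0.
Proof. by apply: (addIr (km_br 0 z)); rewrite -km_brDl !add0r. Qed.

(** Besides the grading of the cobracket, this shows that the cobracket of a Borel element comes
    from the tensor square of the Borel subalgebra, so that [borel_cobracket] is meaningful. *)
Lemma homog2_cobr n x : homog n x -> homog2 n (km_cobr d x).
Proof.
elim=> {n x} [x|i|n|n a x y _ Hx _ Hy|m n x y hx Hx hy Hy].
- by rewrite (km_cobr_H dS); apply: homog2_0.
- rewrite (km_cobr_f dS) -[_ *: _]addr0; apply: homog2_lin; last exact: homog2_0.
  rewrite /wedge addrC -scaleN1r; apply: homog2_lin.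
    by rewrite -[deg i]add0n; apply: homog2_tens; [apply: borel_deg_H|apply: borel_deg_f].
  by rewrite -[deg i]addn0; apply: homog2_tens; [apply: borel_deg_f|apply: borel_deg_H].
- by rewrite km_cobr0; apply: homog2_0.
- by rewrite (km_cobr_linear dS); apply: homog2_lin.
- rewrite (km_cobr_br dS) addrC -scaleN1r; apply: homog2_lin; last exact: homog2_tact.
  by rewrite addnC; apply: homog2_tact.
Qed.

Lemma borel_span x : in_borel (x : L) -> exists (N : nat) (v : nat -> L),
  (forall n, homog n (v n)) /\ x = \sum_(n < N) v n.
Proof.
pose S x := exists (N : nat) (v : nat -> L), (forall n, homog n (v n)) /\ x = \sum_(n < N) v n.
have Shomog n y : homog n y -> S y.
  move=> hy; exists n.+1, (fun m => if m == n then y else 0); split=> [m|].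
    by case: eqVneq => [->|_] //; apply: borel_deg_0.
  by rewrite big_ord_recr /= eqxx big1 ?add0r // => m _; rewrite ltn_eqF.
have Slin a y z : S y -> S z -> S (a *: y + z).
  move=> [N [v [hv ->]]] [M [w [hw ->]]].
  pose trunc P (u : nat -> L) n := if (n < P)%N then u n else 0.
  have truncE P (u : nat -> L) : (P <= maxn N M)%N ->
      \sum_(n < P) u n = \sum_(n < maxn N M) trunc P u n.
    move=> leP; rewrite (big_ord_widen _ (fun n => u n) leP) big_mkcond /=.
    by apply: eq_bigr => n _; rewrite /trunc; case: ifP.
  exists (maxn N M), (fun n => a *: trunc N v n + trunc M w n); split=> [n|].
    by apply: borel_deg_lin; rewrite /trunc; case: ifP => // _; apply: borel_deg_0.
  rewrite (truncE N v (leq_maxl N M)) (truncE M w (leq_maxr N M)).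
  by rewrite scaler_sumr -big_split.
have S0 : S 0 by apply: (Shomog 0%N); apply: borel_deg_0.
have SD y z : S y -> S z -> S (y + z) by move=> Sy Sz; rewrite -[y]scale1r; apply: Slin.
elim=> {x} [x|i||a x y _ Sx _ Sy|x y _ [N [v [hv ->]]] _ [M [w [hw ->]]]] //.
- by apply: (Shomog 0%N); apply: borel_deg_H.
- by apply: (Shomog (deg i)); apply: borel_deg_f.
- exact: Slin.
elim/big_ind: _ => [|u z Su Sz|m _].
- by rewrite km_br0l.
- by rewrite km_brDl; apply: SD.
rewrite linear_sum /=; elim/big_ind: _ => // n _.
by apply: (Shomog (m + n)%N); apply: borel_deg_br.
Qed.

Lemma borel_cobracketE x : tmap sB sB (borel_cobracket D d x) = km_cobr d (sB x).
Proof.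
apply: corestrK; have [N [v [hv ->]]] := borel_span (sinjP x).
elim/big_ind: _ => [|y z [u Eu] [w Ew]|n _].
- by exists 0; rewrite linear0 km_cobr0.
- by exists (u + w); rewrite linearD km_cobrD /= Eu Ew.
by have [t ->] := homog2_cobr (hv n); eexists.
Qed.

Lemma borel_is_lie_bialgebra : is_lie_bialgebra (borel_bracket D) (borel_cobracket D d).
Proof.
have [r rK] := subsp_retraction (borel D).
exact: (lie_bialgebra_embed (km_is_lie_bialgebra dS) rK borel_bracketE borel_cobracketE).
Qed.

Lemma homog_eigen h n x : (forall i, rd_alpha D i h = - (deg i)%:R :> k) ->
  homog n x -> km_br (km_H h) x = n%:R *: (x : L).
Proof.
move=> ah; elim=> {n x} [x|i|n|n a x y _ Hx _ Hy|m n x y _ Hx _ Hy].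
- by rewrite scale0r /km_H km_cls_br; apply/km_clsP/km_HH.
- by rewrite km_br_Hf ah opprK.
- by rewrite linear0 scaler0.
- by rewrite linearP /= Hx Hy; lmod k.
- have gL := km_is_lie D.
  have := br_bracket gL (km_H h) x y; rewrite Hx.
  rewrite -[m%:R *: x]addr0 (br_linl gL) km_br0l.
  rewrite Hy linearZ /= addr0 => /eqP; rewrite eq_sym subr_eq => /eqP ->.
  by rewrite natrD; lmod k.
Qed.

Lemma borel_grading : is_grading G.
Proof.
split=> [x|N s s0 n].
  have [N [v [hv Ex]]] := borel_span (sinjP x).
  exists N, (fun n => corestr (fun s => sB (sG n s)) (v n)).
  apply: (@sinj_inj k L (borel D)); rewrite Ex linear_sum; apply: eq_bigr => n _ /=.
  by apply: esym; apply: (corestrK (f := fun s : subsp (G n) => sB (sG n s))); apply: homog_lift.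
(* The sign offsets the one in [[h, f_i] = - alpha_i(h) f_i], so [h] multiplies [f_i] by [deg i]. *)
have [h ah] := free_hom_eval (fun i => - (deg i)%:R) (rd_alpha_free D).
do 2!apply: sinj_inj; rewrite !linear0.
apply: (eigen_direct char0 (T := km_br (km_H h)) (v := fun n => sB (sG n (s n))) (N := N)) => //.
- by move=> m; apply: homog_eigen (homog_sinj _).
- by have := congr1 sB s0; rewrite linear0 linear_sum.
Qed.

Lemma borel_is_graded :
  is_graded_lie_bialgebra (borel_bracket D) (borel_cobracket D d) G.
Proof.
split; [exact: borel_is_lie_bialgebra | exact: borel_grading | |].
- by move=> m n x y hx hy; rewrite /= /borel_graded_set /= borel_bracketE; apply: borel_deg_br.
- move=> n x hx; have [t Et] := homog2_cobr hx; exists t.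
  have [r rK] := subsp_retraction (borel D).
  by apply: (can_inj (tmapK rK rK)); rewrite borel_cobracketE.
Qed.

End Borel.

(** * Splitting off the degree 0 part *)

Section SubRootDatumDecomposition.
Variables (k : fieldType) (I J : finType) (D : root_datum k I) (d : I -> k).
Variable iota : J -> I.
Hypothesis char0 : [pchar k] =i pred0.
Hypothesis dS : is_symmetrizer (cartan D) d.
Local Notation B := (subsp (borel D)).
Local Notation G := (srd_grading D iota).
Local Notation f := (subsp (B0 D iota)).
Local Notation b := (subsp (b_srd D iota)).
Local Notation sf := (@sinj k B (B0 D iota)).
Local Notation sb := (@sinj k B (b_srd D iota)).
Local Notation P := (@B0_proj k I J D iota).
Local Notation Q := (@b_proj k I J D iota).

Let GB : is_graded_lie_bialgebra (borel_bracket D) (borel_cobracket D d) G.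
Proof. exact: borel_is_graded. Qed.
Let Bgr : is_grading G := graded_sum GB.
Let BL : is_lie_bracket (borel_bracket D) := bialg_lie (graded_bialg GB).

Lemma b_srd_homog n x : sset (G n.+1) x -> sset (b_srd D iota) x.
Proof.
move=> /sinj_surj[s Es].
exists n.+1, (fun m => if m == n then corestr (@sinj _ _ (G m.+1)) x else 0).
rewrite big_ord_recr /= eqxx big1 => [|m _]; last by rewrite ltn_eqF // linear0.
by rewrite add0r corestrK //; exists s.
Qed.

Lemma b_srd_ind (R : B -> Prop) : R 0 -> (forall x y, R x -> R y -> R (x + y)) ->
  (forall n x, sset (G n.+1) x -> R x) -> forall x, sset (b_srd D iota) x -> R x.
Proof.
move=> R0 RD RG _ [N [s ->]]; elim/big_ind: _ => // n _.
exact: (RG n _ (sinjP (s n))).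
Qed.

Lemma srd_decompose x : exists (y : f) (z : b), x = sf y + sb z.
Proof.
have [[|N] [s ->]] := grading_span Bgr x.
  by exists 0, 0; rewrite big_ord0 !linear0 addr0.
rewrite big_ord_recl; exists (s 0%N).
have [|z Ez] := @sinj_surj k B (b_srd D iota) (\sum_(n < N) sinj (s n.+1)).
  by exists N, (fun n => s n.+1).
by exists z; rewrite Ez.
Qed.

Lemma srd_direct (y : f) (z : b) : sf y + sb z = 0 -> y = 0 /\ z = 0.
Proof.
have [N [s Ez]] := sinjP z; rewrite Ez => yz0.
(* [s] starts in degree 1, which leaves slot 0 for [y]. *)
pose t n : subsp (G n) := if n is m.+1 then s m else y.
have t0 := @grading_direct _ _ _ Bgr N.+1 t.
have y0 : y = 0.
  by apply: (t0 _ ord0); rewrite big_ord_recl.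
split=> //; apply: sinj_inj; rewrite linear0 Ez.
by move: yz0; rewrite y0 linear0 add0r.
Qed.

(** The choice made by [xget] is forced because the sum is direct. *)
Lemma B0_projE (y : f) (z : b) : P (sf y + sb z) = y.
Proof.
rewrite /B0_proj; set A := (X in xget _ X).
have Ay : A y.
  have E : sf y + sb z - sf y = sb z by lmod k.
  by rewrite -[A y]/(sset (b_srd D iota) (sf y + sb z - sf y)) E; apply: (sinjP z).
have := xgetI 0 Ay; set y' := xget _ _ => Ay'.
have [w Ew] := @sinj_surj k B (b_srd D iota) _ Ay'.
have [|E _] := @srd_direct (y - y') (z - w) => //; last first.
  by apply/esym/eqP; rewrite -subr_eq0 E.
by rewrite !linearB /= Ew; lmod k.
Qed.

Lemma b_projE (y : f) (z : b) : Q (sf y + sb z) = z.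
Proof.
rewrite /b_proj B0_projE addrC addKr.
by apply: sinj_inj; apply: corestrK; exists z.
Qed.

Lemma proj_dec x : x = sf (P x) + sb (Q x).
Proof. by have [y [z ->]] := srd_decompose x; rewrite B0_projE b_projE. Qed.

Lemma proj_unique x y z : x = sf y + sb z -> P x = y /\ Q x = z.
Proof. by move=> ->; rewrite B0_projE b_projE. Qed.

Lemma proj_linear : linear P /\ linear Q.
Proof.
have E a x y : P (a *: x + y) = a *: P x + P y /\ Q (a *: x + y) = a *: Q x + Q y.
  by apply: proj_unique; rewrite {1}(proj_dec x) {1}(proj_dec y) !linearP /=; lmod k.
by split=> a x y; case: (E a x y).
Qed.

Definition B0_projL : {linear B -> f} :=
  HB.pack P (GRing.isLinear.Build k _ _ _ P proj_linear.1).
#[local] Canonical B0_projL.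
Definition b_projL : {linear B -> b} :=
  HB.pack Q (GRing.isLinear.Build k _ _ _ Q proj_linear.2).
#[local] Canonical b_projL.

Lemma B0_proj_B0 y : P (sf y) = y.
Proof. by have [] := @proj_unique (sf y) y 0; rewrite ?linear0 ?addr0. Qed.
Lemma b_proj_B0 y : Q (sf y) = 0.
Proof. by have [] := @proj_unique (sf y) y 0; rewrite ?linear0 ?addr0. Qed.
Lemma B0_proj_b z : P (sb z) = 0.
Proof. by have [] := @proj_unique (sb z) 0 z; rewrite ?linear0 ?add0r. Qed.
Lemma b_proj_b z : Q (sb z) = z.
Proof. by have [] := @proj_unique (sb z) 0 z; rewrite ?linear0 ?add0r. Qed.

Lemma B0_proj_homog n (s : subsp (G n.+1)) : P (sinj s) = 0.
Proof. by have [z <-] := sinj_surj (b_srd_homog (sinjP s)); rewrite B0_proj_b. Qed.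

Lemma B0_brE x y : sf (B0_br D iota x y) = borel_bracket D (sf x) (sf y).
Proof.
apply: corestrK; apply: (@sinj_surj k B (B0 D iota)).
exact: (graded_br GB (sinjP x) (sinjP y)).
Qed.

Lemma borel_br0r x : borel_bracket D x 0 = 0.
Proof. by have := (lie_bilin BL).1 x (-1) 0 0; rewrite !scaleN1r !addNr. Qed.

Lemma borel_brDr x y z :
  borel_bracket D x (y + z) = borel_bracket D x y + borel_bracket D x z.
Proof. by have := (lie_bilin BL).1 x 1 y z; rewrite !scale1r. Qed.

Lemma b_srd0 : sset (b_srd D iota) 0.
Proof. exact: (subspace_closed (b_srd D iota)).1. Qed.

Lemma b_srdD x y : sset (b_srd D iota) x -> sset (b_srd D iota) y ->
  sset (b_srd D iota) (x + y).
Proof.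
by move=> Bx By; rewrite -[x]scale1r; apply: (subspace_closed (b_srd D iota)).2.
Qed.

(** With [n = 0] this serves the action of the degree 0 part, with [n > 0] the bracket of [b]. *)
Lemma b_srd_bracket n x z : sset (G n) x -> sset (b_srd D iota) z ->
  sset (b_srd D iota) (borel_bracket D x z).
Proof.
move=> Gx; elim/b_srd_ind => [|u v Hu Hv|m u Gu].
- by rewrite borel_br0r; apply: b_srd0.
- by rewrite borel_brDr; apply: b_srdD.
- by apply: (@b_srd_homog (n + m)); rewrite -addnS; apply: (graded_br GB Gx Gu).
Qed.

Lemma b_actE xi x : sb (b_act D iota xi x) = borel_bracket D (sf xi) (sb x).
Proof.
apply: corestrK; apply: (@sinj_surj k B (b_srd D iota)).
exact: (b_srd_bracket (sinjP xi) (sinjP x)).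
Qed.

Lemma b_brE x y : sb (b_br D iota x y) = borel_bracket D (sb x) (sb y).
Proof.
apply: corestrK; apply: (@sinj_surj k B (b_srd D iota)).
elim/b_srd_ind: {x}(sb x) / (sinjP x) => [|u v Hu Hv|m u Gu].
- by rewrite (brC BL) borel_br0r oppr0; apply: b_srd0.
- suff -> : borel_bracket D (u + v) (sb y) =
      borel_bracket D u (sb y) + borel_bracket D v (sb y) by apply: b_srdD.
  by rewrite -[u]scale1r (br_linl BL) !scale1r.
- exact: (b_srd_bracket Gu (sinjP y)).
Qed.

Lemma B0_cobrE xi : tmap sf sf (B0_cobr D iota d xi) = borel_cobracket D d (sf xi).
Proof.
apply: corestrK; have [t ->] := graded_cobr GB (sinjP xi).
by rewrite big_ord1; exists (t ord0).
Qed.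

(** In total degree [n.+1] one of the two legs has positive degree, and [P] kills it: the second leg
    if [i = 0], the first otherwise. *)
Lemma PP_borel_cobr x : tmap P P (borel_cobracket D d (sb x)) = 0.
Proof.
have [_ [clin _ _] _] := graded_bialg GB.
elim/b_srd_ind: {x}(sb x) / (sinjP x) => [|u v Hu Hv|n u Gu].
- by have := clin (-1) 0 0; rewrite !scaleN1r !addNr => ->; rewrite linear0.
- by have := clin 1 u v; rewrite !scale1r => ->; rewrite linearD /= Hu Hv addr0.
have [t ->] := graded_cobr GB Gu; rewrite linear_sum big1 //= => -[[|i] lt_i] _ /=.
  by apply: tmap_comp0r => s; apply: B0_proj_homog.
by apply: tmap_comp0l => s; apply: B0_proj_homog.
Qed.

(** [PP_borel_cobr] leaves the second leg of [tmap P id] of the cobracket in [b], so the preimage in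
    [b_coact] exists and [Q] computes it. *)
Lemma b_coactE x : b_coact D iota d x = tmap P Q (borel_cobracket D d (sb x)).
Proof.
have [r rK] := subsp_retraction (b_srd D iota).
apply: (can_inj (tmapK (f := idfun) (f' := idfun) _ rK)) => //.
have PPx := PP_borel_cobr x.
have E t : tmap P idfun t = tmap idfun sb (tmap P Q t) + tmap idfun sf (tmap P P t).
  tens_ext t as u v; rewrite !tmapE /= -tensDr addrC.
  by rewrite -proj_dec.
rewrite -[LHS]/(tmap id sb (b_coact D iota d x)) corestrK /=.
  by rewrite -[LHS]/(tmap P idfun _) E PPx linear0 addr0.
exists (tmap P Q (borel_cobracket D d (sb x))).
by rewrite -[LHS]/(tmap idfun sb _) -[RHS]/(tmap P idfun _) E PPx linear0 addr0.
Qed.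

Lemma b_srd_braided :
  is_braided_lie_bialgebra (B0_br D iota) (B0_cobr D iota d)
    (b_act D iota) (b_coact D iota d) (b_br D iota) (b_cobr D iota d).
Proof.
apply: (boson_braided (graded_bialg GB) B0_proj_B0 b_proj_b B0_proj_b b_proj_B0 proj_dec
  B0_brE b_actE b_brE B0_cobrE b_coactE _ PP_borel_cobr) => x.
by [].
Qed.

Lemma b_srd_bosonisation : lie_bialgebra_isomorphic
  (borel_bracket D) (borel_cobracket D d)
  (boson_br (B0_br D iota) (b_act D iota) (b_br D iota))
  (boson_cobr (B0_cobr D iota d) (b_coact D iota d) (b_cobr D iota d)).
Proof.
apply: (boson_isomorphic (graded_bialg GB) B0_proj_B0 b_proj_b B0_proj_b b_proj_B0 proj_dec
  B0_brE b_actE b_brE B0_cobrE b_coactE _ PP_borel_cobr) => x.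
by [].
Qed.

End SubRootDatumDecomposition.

Theorem theorem3p8 (k : closedFieldType) (k_char0 : [pchar k] =i pred0)
    (I J : finType) (D : root_datum k I) (D' : root_datum k J)
    (d : I -> k) (d' : J -> k) (iota : J -> I)
    (C_symmetrizable : is_symmetrizer (cartan D) d)
    (C'_symmetrizable : is_symmetrizer (cartan D') d')
    (D'_sub_D : is_sub_root_datum D' D iota) :
  [/\ is_graded_lie_bialgebra
        (borel_bracket D) (borel_cobracket D d) (srd_grading D iota),
      is_braided_lie_bialgebra (B0_br D iota) (B0_cobr D iota d)
        (b_act D iota) (b_coact D iota d) (b_br D iota) (b_cobr D iota d)
    & lie_bialgebra_isomorphic
        (borel_bracket D) (borel_cobracket D d)
        (boson_br (B0_br D iota) (b_act D iota) (b_br D iota))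
        (boson_cobr (B0_cobr D iota d) (b_coact D iota d) (b_cobr D iota d))].
Proof.
by split; [apply: borel_is_graded | apply: b_srd_braided | apply: b_srd_bosonisation].
Qed.
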